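(* Let $r$ be a positive integer, $\boldsymbol{\omega}=(\omega_1,\ldots,\omega_r)$ an $r$-tuple of positive reals and $a\ge0$. If $0<x<1$, then \[ (a+|\boldsymbol{\omega}|)^xI_r(x;\boldsymbol{\omega},a)=r!\,x^{-r}+\sum_{m=1}^\infty c_{r,m}(\boldsymbol{\omega},a)\,x^{m-r}, \] where \[ c_{r,m}(\boldsymbol{\omega},a)=\sum_{t=1}^{\min\{m,r\}}(-1)^{m-t}\sum_{s=1}^t\sum_{\substack{\boldsymbol{k}\in(\mathbb{Z}_{\ge1})^s\\k_1+\cdots+k_s=t}}\sum_{\substack{\boldsymbol{l}\in(\mathbb{Z}_{\ge0})^s\\l_1+\cdots+l_s=m-t}}(r-t)!\,k_1!\cdots k_s!\prod_{i=1}^s\binom{k_i+l_i-1}{l_i}\sum_{K_1,\ldots,K_s}\mathrm{Li}_{\boldsymbol{k}+\boldsymbol{l}}(z_1,\ldots,z_s), \] the innermost sum runs over ordered $s$-tuples $(K_1,\ldots,K_s)$ of pairwise disjoint subsets of $R=\{1,\ldots,r\}$ with $|K_i|=k_i$, $K_0=R\setminus\bigsqcup_{i=1}^sK_i$, and \[ z_j=\frac{a+|\boldsymbol{\omega}_{K_0\sqcup K_1\sqcup\cdots\sqcup K_{j-1}}|}{a+|\boldsymbol{\omega}_{K_0\sqcup K_1\sqcup\cdots\sqcup K_{j}}|}\quad(j=1,\ldots,s). \]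
   Context: For real $x>0$, $I_r(x;\boldsymbol{\omega},a)=\int_1^\infty\cdots\int_1^\infty\frac{dt_1\cdots dt_r}{t_1\cdots t_r(\omega_1t_1+\cdots+\omega_rt_r+a)^x}$. For $J\subset R$, $|\boldsymbol{\omega}_J|=\sum_{j\in J}\omega_j$ (with $|\boldsymbol{\omega}_\emptyset|=0$) and $|\boldsymbol{\omega}|=\omega_1+\cdots+\omega_r$. For $\boldsymbol{k}=(k_1,\ldots,k_s)\in(\mathbb{Z}_{\ge1})^s$ and complex $z_i$ with $|z_i|<1$, the multiple polylogarithm is $\mathrm{Li}_{\boldsymbol{k}}(z_1,\ldots,z_s)=\sum_{1\le n_1<\cdots<n_s}\frac{z_1^{n_1}\cdots z_s^{n_s}}{n_1^{k_1}\cdots n_s^{k_s}}$; $\boldsymbol{k}+\boldsymbol{l}$ is the componentwise sum. *)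

(* Defs.v *)
From HB Require Import structures.
From mathcomp Require Import all_boot all_order all_algebra.
From mathcomp Require Import all_classical all_reals all_analysis.

Set Implicit Arguments.
Unset Strict Implicit.
Unset Printing Implicit Defensive.

Import Order.TTheory GRing.Theory Num.Theory.
Import numFieldNormedType.Exports.

Local Open Scope ring_scope.

(* \int_1^oo ... \int_1^oo f(t_1, ..., t_r) dt_r ... dt_1 as an iterated
   Lebesgue integral with values in \bar R. *)
Fixpoint iter_integral1y (R : realType) (r : nat) :
    (r.-tuple R -> \bar R) -> \bar R :=
  match r with
  | 0 => fun f => f [tuple]
  | r'.+1 => fun f =>
      (\int[lebesgue_measure]_(t in `[1%R, +oo[%classic)
         iter_integral1y (fun u : r'.-tuple R => f [tuple of t :: u]))%E
  end.

Definition I_integral (R : realType) (r : nat) (x : R) (omega : 'I_r -> R)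
    (a : R) : \bar R :=
  iter_integral1y (fun t : r.-tuple R =>
    (((\prod_(i < r) tnth t i)
      * (\sum_(i < r) omega i * tnth t i + a) `^ x)^-1)%:E).

(* |omega_J| *)
Definition sum_on (R : realType) (r : nat) (omega : 'I_r -> R)
    (J : {set 'I_r}) : R := \sum_(j in J) omega j.

Definition strict_indices (s N : nat) : pred {ffun 'I_s -> 'I_N.+1} :=
  [pred n : {ffun 'I_s -> 'I_N.+1} |
    [forall i : 'I_s, (0 < n i)%N]
    && [forall i : 'I_s, forall j : 'I_s, (i < j)%N ==> (n i < n j)%N]].

(* The series is summed by letting the largest index n_s run to infinity; it is
   absolutely convergent when all |z_i| < 1. The scalars K can be the reals or
   the complex numbers. *)
Definition Li (K : numFieldType) (s : nat) (k : 'I_s -> nat) (z : 'I_s -> K)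
    : K :=
  limn (fun N : nat =>
    \sum_(n : {ffun 'I_s -> 'I_N.+1} | strict_indices n)
      \prod_(i < s) (z i ^+ n i / (n i)%:R ^+ k i)).

Definition disjoint_family (r s : nat) (k : 'I_s -> nat) :
    pred {ffun 'I_s -> {set 'I_r}} :=
  [pred K : {ffun 'I_s -> {set 'I_r}} |
    [forall i : 'I_s, #|K i| == k i]
    && [forall i : 'I_s, forall j : 'I_s,
          (i != j) ==> [disjoint K i & K j]]].

(* Tuples (K_1, ..., K_s) are indexed from 0 by 'I_s, so this is
   K_0 \cup K_1 \cup ... \cup K_j with K_0 the complement of all the K_i. *)
Definition K_upto (r s : nat) (K : 'I_s -> {set 'I_r}) (j : nat) : {set 'I_r} :=
  (~: (\bigcup_(i < s) K i) :|: \bigcup_(i < s | (i < j)%N) K i)%SET.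

Definition z_arg (R : realType) (r : nat) (omega : 'I_r -> R) (a : R) (s : nat)
    (K : 'I_s -> {set 'I_r}) (j : 'I_s) : R :=
  (a + sum_on omega (K_upto K j)) / (a + sum_on omega (K_upto K j.+1)).

Definition c_coef (R : realType) (r : nat) (omega : 'I_r -> R) (a : R)
    (m : nat) : R :=
  \sum_(1 <= t < (minn m r).+1) (-1) ^+ (m - t) *
  \sum_(1 <= s < t.+1)
  \sum_(k : {ffun 'I_s -> 'I_t.+1} |
      [forall i : 'I_s, (1 <= k i)%N] && (\sum_(i < s) k i == t)%N)
  \sum_(l : {ffun 'I_s -> 'I_(m - t).+1} | (\sum_(i < s) l i == m - t)%N)
    ((r - t)`! * \prod_(i < s) (k i)`!
      * \prod_(i < s) 'C(k i + l i - 1, l i))%N%:R *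
    \sum_(K : {ffun 'I_s -> {set 'I_r}} |
        disjoint_family (fun i => k i : nat) K)
      Li (fun i => (k i + l i)%N) (z_arg omega a K).

(* Main.v *)
(* Write S = a + sum_i omega_i t_i and A = a + |omega|. Splitting
   S^(-x) = S * S^(-x-1) and integrating the summand omega_i t_i exactly in t_i
   gives
     I_r(x; a) = a I_r(x+1; a) + x^-1 sum_i I_(r-1)(x; a + omega_i),
   where omega_i is removed from the weights on the right. Normalized by A^x,
   and with the first term kept while the second is iterated, this becomes a
   recursion from x to x+1 over subsets of the variables. Unrolling it N + 1
   times turns A^x I_r into a sum over all f : R -> {0, ..., N} of
     prod_w |f^-1(w)|! (x+w)^-|f^-1(w)| (a + |omega_(f <= w)|) / A,
   up to a remainder that vanishes because (a + |omega_U|) / A < 1 for U <> R.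
   Grouping f by its level sets K_0 = f^-1(0) and K_j = f^-1(n_j) gives
     (r-t)! x^-(r-t) prod_j k_j! z_j^(n_j) / (n_j + x)^(k_j),
   and expanding (n + x)^-k in powers of x < 1 <= n gives the polylogarithms. *)
Require Import Defs.
From mathcomp Require Import all_boot all_order all_algebra.
From mathcomp Require Import all_classical all_reals all_analysis.
From mathcomp Require Import measurable_realfun ring zify finset.
Import Order.TTheory GRing.Theory Num.Theory.
Import numFieldNormedType.Exports.
Local Open Scope classical_set_scope.
Local Open Scope ring_scope.

Set Implicit Arguments.
Unset Strict Implicit.
Unset Printing Implicit Defensive.

(** * The iterated integral and its recursion *)

(** The recursion moves x to x + 1, so the remainder after n steps lives at x + n. It is therefore
    estimated uniformly over all shifts x + k, by induction on the number of variables, starting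
    from S >= A on the domain, where all t_i >= 1. Level 0 is kept apart because x^-k has no
    expansion at x = 0: it is the source of the negative powers x^-(r-t) and of the distinguished
    block K_0. The exponents of the z_j come from telescoping: the factor of level w is the product
    of the z_j with n_j > w, so z_j occurs once for each w < n_j. The last step interchanges two
    limits, N -> oo and the number of powers of x. For fixed N only finitely many (n_1, ..., n_s)
    occur, and the expansion is a finite sum of products of binomial series. The terms of prod_j (1
    - x)^-k_j times the constant prod_j (1 - z_j)^-1 form a majorant independent of N, summable
    because x < 1, and allow N -> oo in each coefficient. *)

Definition ind1y (R : realType) : R -> R := \1_(`[1%R, +oo[%classic).

(** The indicator is part of the kernel, so that every integral runs over the whole line and [Iw] is
    nonnegative and measurable in its parameter without a side condition on the sign of
    [a + w0 * t]. *)
Definition ker1y (R : realType) (t : R) : R := ind1y t * t `^ (-1).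

(* The integral of the statement with the weights collected in a list, so that
   single weights can be removed. *)
Fixpoint Iw (R : realType) (w : seq R) (x a : R) : \bar R :=
  if w is w0 :: w' then
    (\int[lebesgue_measure]_t ((ker1y t)%:E * Iw w' x (a + w0 * t)))%E
  else (a `^ (- x))%:E.

Section Iw_theory.
Variable R : realType.
Implicit Types (w : seq R) (x a b t : R).
Local Notation mu := (@lebesgue_measure R).

Lemma ind1y_ge0 t : 0 <= ind1y t.
Proof. by rewrite /ind1y indicE ler0n. Qed.

Lemma ker1y_ge0 t : 0 <= ker1y t.
Proof. by rewrite mulr_ge0 ?ind1y_ge0 ?powR_ge0. Qed.

Lemma ind1y_eq0 t : t < 1 -> ind1y t = 0.
Proof. by move=> t1; rewrite /ind1y indicE memNset//= in_itv/= andbT leNgt t1. Qed.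

Lemma ind1y_eq1 t : 1 <= t -> ind1y t = 1.
Proof. by move=> t1; rewrite /ind1y indicE mem_set//= in_itv/= andbT. Qed.

Lemma ker1y_eq0 t : t < 1 -> ker1y t = 0.
Proof. by move=> t1; rewrite /ker1y ind1y_eq0// mul0r. Qed.

Lemma ker1yE t : 1 <= t -> ker1y t = t^-1.
Proof.
by move=> t1; rewrite /ker1y ind1y_eq1// mul1r powR_inv1// (le_trans _ t1).
Qed.

Lemma measurable_ind1y : measurable_fun [set: _] (@ind1y R).
Proof. by apply: measurable_indic; exact: measurable_itv. Qed.

Lemma measurable_ker1y : measurable_fun [set: _] (@ker1y R).
Proof. by apply: measurable_funM; [exact: measurable_ind1y|exact: measurable_powR]. Qed.

Lemma Iw_ge0 w x a : (0 <= Iw w x a)%E.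
Proof.
elim: w a => [|w0 w IH] a /=; first by rewrite lee_fin powR_ge0.
by apply: integral_ge0 => t _; rewrite mule_ge0// lee_fin ker1y_ge0.
Qed.

(** Each integral is a function of the parameter inside the next one; Tonelli's theorem gives its
    measurability, one variable at a time. *)
Lemma measurable_Iw w x : measurable_fun [set: _] (Iw w x).
Proof.
elim: w => [|w0 w IH] /=.
  by apply/measurable_EFinP; exact: measurable_powR.
have := @measurable_fun_fubini_tonelli_F _ _ _ _ _ mu
  (fun p : R * R => ((ker1y p.2)%:E * Iw w x (p.1 + w0 * p.2)))%E.
apply.
- apply: emeasurable_funM.
    by apply/measurable_EFinP; apply: (measurableT_comp measurable_ker1y).
  apply: (measurableT_comp IH); apply: measurable_funD => //.
  by apply: measurable_funM.
- by move=> p; rewrite mule_ge0 ?Iw_ge0// lee_fin ker1y_ge0.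
Qed.

Lemma measurable_Iw_aff w x a b : measurable_fun [set: _] (fun t => Iw w x (a + b * t)).
Proof.
apply: (measurableT_comp (measurable_Iw w x)).
by apply: measurable_funD => //; apply: measurable_funM.
Qed.

Lemma measurable_ker_Iw w x a b (c : R -> R) : measurable_fun [set: _] c ->
  measurable_fun [set: _] (fun t => (c t)%:E * Iw w x (a + b * t))%E.
Proof.
by move=> mc; apply: emeasurable_funM (measurable_Iw_aff _ _ _ _); apply/measurable_EFinP.
Qed.

Lemma powR_cvgy0 x : 0 < x -> y `^ (- x) @[y --> +oo%R] --> (0 : R).
Proof.
move=> x0.
apply/cvgr0Pnorm_le => e e0; near=> y.
have y0 : 0 < y by near: y; exact: nbhs_pinfty_gt.
rewrite ger0_norm ?powR_ge0// powRN invf_ple ?posrE ?powR_gt0//.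
have -> : e^-1 = (e^-1 `^ (x^-1)) `^ x.
  by rewrite -powRrM mulVf ?gt_eqF// powRr1 ?invr_ge0 ?ltW.
rewrite ge0_ler_powR ?nnegrE ?powR_ge0 ?(ltW x0) ?(ltW y0)//.
Unshelve. all: by end_near. Qed.

Lemma is_derive_powR_aff a b x t : 0 < a + b * t ->
  is_derive t 1 (fun t => (a + b * t) `^ x) (x * b * (a + b * t) `^ (x - 1)).
Proof.
move=> p0.
have H1 : is_derive t 1 (fun t => a + b * t) b.
  have := @is_deriveD _ _ _ (cst a) (fun t => b * t) t 1 0 b.
  rewrite add0r; apply.
  have -> : (fun t : R => b * t) = b \*: id by [].
  by rewrite -[X in is_derive _ _ _ X]mulr1; apply: is_deriveZ.
have H2 := @is_derive1_comp _ (fun y : R => y `^ x) (fun t => a + b * t) t _ _ (is_derive1_powR x p0) H1.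
by rewrite mulrAC.
Qed.

Lemma integral_powR_aff a b x : 0 <= a -> 0 < b -> 0 < x ->
  (\int[mu]_t (((ind1y t * b))%:E * ((a + b * t) `^ (- (x + 1)))%:E) =
   (x^-1 * (a + b) `^ (- x))%:E)%E.
Proof.
move=> a0 b0 x0.
have pos t : 1 <= t -> 0 < a + b * t.
  by move=> t1; rewrite ltr_wpDl// mulr_gt0// (lt_le_trans _ t1).
pose f t := b * (a + b * t) `^ (- (x + 1)).
pose F t := - x^-1 * (a + b * t) `^ (- x).
have Fd t : 1 <= t -> is_derive t 1 F (f t).
  move=> t1.
  have := @is_deriveZ _ _ _ _ (- x^-1) t 1 _ (is_derive_powR_aff (- x) (pos t t1)).
  rewrite /F /f opprD; congr (is_derive _ _ _ _).
  by rewrite /GRing.scale/= !mulrA mulrNN mulVf ?gt_eqF// mul1r.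
have fc t : 1 <= t -> {for t, continuous f}.
  move=> t1; apply: differentiable_continuous; apply/derivable1_diffP.
  have := @is_deriveZ _ _ _ _ b t 1 _ (is_derive_powR_aff (- (x+1)) (pos t t1)).
  by case.
transitivity (\int[mu]_(t in `[1%R, +oo[) (f t)%:E)%E.
  rewrite [RHS]integral_mkcond; apply: eq_integral => t _.
  rewrite patchE; have [t1|t1] := ltP t 1.
    by rewrite memNset /= ?in_itv/= ?andbT ?leNgt ?t1// ind1y_eq0// mul0r mul0e.
  by rewrite mem_set /= ?in_itv/= ?andbT// ind1y_eq1// mul1r.
rewrite (@ge0_continuous_FTC2y _ f F 1 0).
- by rewrite /F mulr1 -EFinB sub0r mulNr opprK.
- by move=> t t1; rewrite mulr_ge0 ?powR_ge0 ?ltW.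
- apply: continuous_in_subspaceT => t /set_mem; rewrite /= in_itv/= andbT; exact: fc.
- rewrite -[0](mulr0 (- x^-1)); apply: (@cvgM _ _ _ _ (cst (- x^-1))); first exact: cvg_cst.
  have := @cvg_comp _ _ _ (fun t => a + b * t) (fun y => y `^ (-x)) (pinfty_nbhs R) (pinfty_nbhs R) _ _ (powR_cvgy0 x0).
  apply.
  apply/cvgryPge => A; near=> t.
  have : (A / b) <= t by near: t; apply: nbhs_pinfty_ge; exact: num_real.
  by rewrite ler_pdivrMr// mulrC => /le_trans; apply; rewrite lerDr.
- by move=> t t1; have [] := Fd t (ltW t1).
- apply: cvg_at_right_filter; apply: differentiable_continuous.
  by apply/derivable1_diffP; have [] := Fd 1 (lexx _).
- move=> t; rewrite in_itv/= andbT => t1; rewrite derive1E.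
  by have [_ ] := Fd t (ltW t1).
Unshelve. all: by end_near. Qed.

(** The factor [w0] is the derivative of [b + w0 * t], so integrating t exactly lowers the exponent
    by one and leaves the value at t = 1. With further variables present, Tonelli's theorem moves
    the t-integral inside, where the shift [b] absorbs the other variable. *)
Lemma integral_Iw_shift w x b (w0 : R) : all (fun v => 0 < v) w -> 0 < x -> 0 <= b -> 0 < w0 ->
  (\int[mu]_t ((ind1y t * w0)%:E * Iw w (x + 1) (b + w0 * t)) =
   x^-1%:E * Iw w x (b + w0))%E.
Proof.
move=> + x0; elim: w b => [|w1 w IH] b /=.
  by move=> _ b0 w00; rewrite integral_powR_aff// EFinM.
move=> /andP[w10 wpos] b0 w00.
have mc : measurable_fun [set: _] (fun t : R => ind1y t * w0).
  by apply: measurable_funM => //; exact: measurable_ind1y.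
have c0 t : 0 <= ind1y t * w0 by rewrite mulr_ge0 ?ind1y_ge0 ?ltW.
pose f := (fun p : R * R => (ind1y p.1 * w0)%:E * ((ker1y p.2)%:E *
   Iw w (x + 1) (b + w0 * p.1 + w1 * p.2)))%E.
transitivity (\int[mu]_t \int[mu]_u f (t, u))%E.
  apply: eq_integral => t _; rewrite /f/= ge0_integralZl//.
  - by apply: measurable_ker_Iw; exact: measurable_ker1y.
  - by move=> u _; rewrite mule_ge0 ?Iw_ge0// lee_fin ker1y_ge0.
  - by rewrite lee_fin.
rewrite fubini_tonelli; last 2 first.
- apply: emeasurable_funM.
    apply/measurable_EFinP; apply: measurable_funM => //.
    by apply: (measurableT_comp measurable_ind1y).
  apply: emeasurable_funM.
    by apply/measurable_EFinP; apply: (measurableT_comp measurable_ker1y).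
  apply: (measurableT_comp (measurable_Iw _ _)).
  by apply: measurable_funD; [apply: measurable_funD => //|]; apply: measurable_funM.
- by move=> p; rewrite /f !mule_ge0 ?Iw_ge0// lee_fin ?ker1y_ge0.
rewrite -ge0_integralZl//; last 3 first.
- by apply: measurable_ker_Iw; exact: measurable_ker1y.
- by move=> u _; rewrite mule_ge0 ?Iw_ge0// lee_fin ker1y_ge0.
- by rewrite lee_fin invr_ge0 ltW.
apply: eq_integral => u _; rewrite /f/=.
have [u1|u1] := ltP u 1.
  rewrite ker1y_eq0// mul0e mule0 integral0_eq// => t _.
  by rewrite mul0e mule0.
rewrite muleCA addrAC -IH//; last first.
  by rewrite addr_ge0// mulr_ge0 ?(ltW w10)// (le_trans _ u1).
rewrite -ge0_integralZl//; last 3 first.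
- by apply: measurable_ker_Iw.
- by move=> t _; rewrite mule_ge0 ?Iw_ge0// lee_fin.
- by rewrite lee_fin ker1y_ge0.
by apply: eq_integral => t _; rewrite muleCA addrAC.
Qed.

Section removal.
Variables (T : eqType) (omega : T -> R).
Hypothesis omega_gt0 : forall i, 0 < omega i.

Let all_gt0 (s : seq T) : all (fun v => 0 < v) (map omega s).
Proof. by apply/allP => v /mapP[i _ ->]. Qed.

(* Split S^(-x) = S * S^(-x-1) with S = a + sum_i omega_i t_i; the summand
   omega_i t_i cancels dt_i / t_i and the integral over t_i becomes exact. *)
Lemma Iw_rec (s : seq T) x a : uniq s -> 0 < x -> 0 <= a -> (0 < a) || (s != [::]) ->
  (Iw (map omega s) x a = a%:E * Iw (map omega s) (x + 1) a +
     x^-1%:E * \sum_(i <- s) Iw (map omega (rem i s)) x (a + omega i))%E.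
Proof.
move=> + x0; elim: s a => [|i0 s IH] a /=.
  rewrite orbF big_nil mule0 adde0 -EFinM => _ _ a0; congr EFin.
  by rewrite opprD powRD ?(gt_eqF a0) ?implybT// mulrCA powR_inv1 ?ltW// mulfV ?mulr1// gt_eqF.
case/andP => i0s us a0 _.
have xV : (0 <= x^-1%:E)%E by rewrite lee_fin invr_ge0 ltW.
have kI b y (s' : seq T) t : (0 <= (ker1y t)%:E * Iw (map omega s') y (b + omega i0 * t))%E.
  by rewrite mule_ge0 ?Iw_ge0// lee_fin ker1y_ge0.
(* The induction hypothesis at [a + omega i0 * t] supplies that number as a factor. Divided by t it
   splits into a / t, which rebuilds the full integral, and the constant [omega i0], which gives the
   exact integral. *)
transitivity (\int[mu]_t (
    (a%:E * ((ker1y t)%:E * Iw (map omega s) (x + 1) (a + omega i0 * t)) +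
     (ind1y t * omega i0)%:E * Iw (map omega s) (x + 1) (a + omega i0 * t)) +
    x^-1%:E * \sum_(i <- s) (ker1y t)%:E * Iw (map omega (rem i s)) x (a + omega i + omega i0 * t)))%E.
  apply: eq_integral => t _.
  have [t1|t1] := ltP t 1.
    rewrite ker1y_eq0// ind1y_eq0// !(mul0e,mule0,mul0r,add0e) big1 ?mule0// => i _.
    by rewrite mul0e.
  have p0 : 0 < a + omega i0 * t by rewrite ltr_wpDl// mulr_gt0// (lt_le_trans _ t1).
  rewrite IH ?p0 ?(ltW p0)//.
  rewrite ge0_muleDr ?mule_ge0 ?sume_ge0 ?Iw_ge0 ?lee_fin ?(ltW p0)//; last first.
    by move=> i _; exact: Iw_ge0.
  congr (_ + _)%E.
    rewrite !muleA -!EFinM -ge0_muleDl; last 2 first.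
    - by rewrite lee_fin mulr_ge0 ?ker1y_ge0.
    - by rewrite lee_fin mulr_ge0 ?ind1y_ge0// ltW.
    congr (_ * _)%E; rewrite -EFinD ker1yE// ind1y_eq1//; congr EFin.
    by field; rewrite gt_eqF// (lt_le_trans _ t1).
  rewrite muleCA; congr (_ * _)%E.
  rewrite ge0_sume_distrr; last by move=> i _; exact: Iw_ge0.
  by apply: eq_bigr => i _; rewrite addrAC.
have mk b y (s' : seq T) : measurable_fun [set: _]
    (fun t => (ker1y t)%:E * Iw (map omega s') y (b + omega i0 * t))%E.
  by apply: measurable_ker_Iw; exact: measurable_ker1y.
have mi : measurable_fun [set: _]
    (fun t => (ind1y t * omega i0)%:E * Iw (map omega s) (x + 1) (a + omega i0 * t))%E.
  by apply: measurable_ker_Iw; apply: measurable_funM => //; exact: measurable_ind1y.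
have i_ge0 t : (0 <= (ind1y t * omega i0)%:E * Iw (map omega s) (x + 1) (a + omega i0 * t))%E.
  by rewrite mule_ge0 ?Iw_ge0// lee_fin mulr_ge0 ?ind1y_ge0// ltW.
have ak_ge0 t : (0 <= a%:E * ((ker1y t)%:E * Iw (map omega s) (x + 1) (a + omega i0 * t)))%E.
  by rewrite mule_ge0.
have mak : measurable_fun [set: _]
    (fun t => a%:E * ((ker1y t)%:E * Iw (map omega s) (x + 1) (a + omega i0 * t)))%E.
  exact: measurable_funeM.
have ms : measurable_fun [set: _] (fun t => \sum_(i <- s) (ker1y t)%:E *
    Iw (map omega (rem i s)) x (a + omega i + omega i0 * t))%E.
  exact: emeasurable_sum.
rewrite ge0_integralD//; last 4 first.
- by move=> t _; rewrite adde_ge0.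
- exact: emeasurable_funD.
- by move=> t _; rewrite mule_ge0// sume_ge0.
- exact: measurable_funeM.
rewrite ge0_integralD// ge0_integralZl//; last exact: mk.
rewrite integral_Iw_shift// -addeA ge0_integralZl//; last first.
  by move=> t _; rewrite sume_ge0.
have -> := @ge0_integral_sum _ _ _ mu [set: R] measurableT _ _
  (fun i => mk (a + omega i) x (rem i s)) (fun i t _ => kI (a + omega i) x (rem i s) t) s.
congr (_ + _)%E; rewrite big_cons eqxx ge0_muleDr ?Iw_ge0 ?sume_ge0//; last first.
  by move=> i _; case: ifP => _; rewrite ?Iw_ge0// (Iw_ge0 (_ :: _)).
congr (_ + _ * _)%E.
rewrite [LHS]big_seq [RHS]big_seq; apply: eq_bigr => i si.
by rewrite ifN//; apply: contraNneq i0s => ->.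
Qed.

(** Induction on the number of variables through [Iw_rec]: the terms of its sum have fewer
    variables, and its first term has exponent x + 1, which leaves one power to spare. *)
Lemma Iw_fin_num (s : seq T) x a : uniq s -> 0 < x -> 0 <= a -> (0 < a) || (s != [::]) ->
  Iw (map omega s) x a \is a fin_num.
Proof.
have [n] := ubnP (size s); elim: n s x a => // n IH [|i0 s] x a sn us x0 a0 as0 //.
have rem_fin i : i \in i0 :: s -> Iw (map omega (rem i (i0 :: s))) x (a + omega i) \is a fin_num.
  move=> si; apply: IH => //.
  - by rewrite size_rem.
  - exact: rem_uniq.
  - by rewrite addr_ge0// ltW.
  - by rewrite ltr_wpDl.
rewrite Iw_rec// fin_numD; apply/andP; split; last first.
  rewrite fin_numM//; apply/sum_fin_numP => i si _; exact: rem_fin.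
have [->|an0] := eqVneq a 0; first by rewrite mul0e.
rewrite fin_numM// ge0_fin_numE ?Iw_ge0//=.
(* Since 1 / t <= 1 for t >= 1, the kernel is bounded by the indicator; at exponent x + 1 the
   integral over the first variable is then the exact one of [integral_Iw_shift]. *)
apply: (@le_lt_trans _ _ ((omega i0)^-1%:E * (x^-1%:E * Iw (map omega s) x (a + omega i0))))%E.
  rewrite -integral_Iw_shift//.
  have mc : measurable_fun [set: _] (fun t : R => ind1y t * omega i0).
    by apply: measurable_funM => //; exact: measurable_ind1y.
  have c0 t : 0 <= ind1y t * omega i0 by rewrite mulr_ge0 ?ind1y_ge0 ?ltW.
  rewrite -ge0_integralZl//; last 3 first.
  - exact: measurable_ker_Iw.
  - by move=> t _; rewrite mule_ge0 ?Iw_ge0// lee_fin.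
  - by rewrite lee_fin invr_ge0 ltW.
  apply: ge0_le_integral => //.
  - by move=> t _; rewrite mule_ge0 ?Iw_ge0// lee_fin ker1y_ge0.
  - by apply: measurable_ker_Iw; exact: measurable_ker1y.
  - by apply: measurable_funeM; apply: measurable_ker_Iw.
  move=> t _; rewrite muleA -EFinM mulrCA mulVf ?gt_eqF// mulr1.
  rewrite lee_wpmul2r ?Iw_ge0// lee_fin.
  have [t1|t1] := ltP t 1; first by rewrite ker1y_eq0// ind1y_eq0.
  by rewrite ker1yE// ind1y_eq1// invf_le1// (lt_le_trans _ t1).
rewrite -ge0_fin_numE; last by rewrite !mule_ge0 ?Iw_ge0// lee_fin invr_ge0 ltW.
rewrite !fin_numM//; have := rem_fin i0; rewrite /= eqxx; apply.
exact: mem_head.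
Qed.

End removal.

(** On the domain S is at least [a] plus the sum of the weights, hence at least c, so c S^(-x-1) <=
    S^(-x) pointwise. The induction keeps [c] fixed while [a] grows to [a + w0 * t]. *)
Lemma Iw_le w x a c : all (fun v => 0 < v) w -> 0 <= a ->
  0 < c -> c <= a + \sum_(v <- w) v -> (c%:E * Iw w (x + 1) a <= Iw w x a)%E.
Proof.
move=> + + c0; elim: w a => [|w0 w IH] a /=.
  move=> _ a0; rewrite big_nil addr0 -EFinM lee_fin => ca.
  have ap : 0 < a by exact: lt_le_trans ca.
  rewrite opprD powRD ?(gt_eqF ap) ?implybT// powR_inv1// mulrCA ler_piMr ?powR_ge0//.
  by rewrite ler_pdivrMr// mul1r.
move=> /andP[w00 wp] a0; rewrite big_cons => ca.
rewrite -ge0_integralZl//; last 3 first.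
- by apply: measurable_ker_Iw; exact: measurable_ker1y.
- by move=> t _; rewrite mule_ge0 ?Iw_ge0// lee_fin ker1y_ge0.
- by rewrite lee_fin ltW.
apply: ge0_le_integral => //.
- by move=> t _; rewrite !mule_ge0 ?Iw_ge0// lee_fin ?ker1y_ge0// ltW.
- by apply: measurable_funeM; apply: measurable_ker_Iw; exact: measurable_ker1y.
- by apply: measurable_ker_Iw; exact: measurable_ker1y.
move=> t _; rewrite muleCA.
have [t1|t1] := ltP t 1; first by rewrite ker1y_eq0// !mul0e.
rewrite lee_wpmul2l ?lee_fin ?ker1y_ge0//; apply: IH => //.
  by rewrite addr_ge0// mulr_ge0 ?(ltW w00)// (le_trans _ t1).
by apply: (le_trans ca); rewrite addrA lerD2r lerD2l ler_peMr// ltW.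
Qed.

(** The integrand carries the whole product of the variables inside the innermost integral; [c]
    collects the outer variables already passed. *)
Lemma iter_integral1yE (r : nat) (om : 'I_r -> R) x a c : 0 <= c ->
  (forall i, 0 < om i) ->
  (iter_integral1y (fun t : r.-tuple R =>
    (((c * \prod_(i < r) tnth t i)
      * (\sum_(i < r) om i * tnth t i + a) `^ x)^-1)%:E) =
   c^-1%:E * Iw [seq om i | i <- enum 'I_r] x a)%E.
Proof.
elim: r om a c => [|r IH] om a c c0 om0 /=.
  by rewrite enum_ord0 /= !big_ord0 mulr1 add0r -EFinM powRN invfM.
rewrite enum_ordSl/= -map_comp integral_mkcond -ge0_integralZl//; last 3 first.
- by apply: measurable_ker_Iw; exact: measurable_ker1y.
- by move=> t _; rewrite mule_ge0 ?Iw_ge0// lee_fin ker1y_ge0.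
- by rewrite lee_fin invr_ge0.
apply: eq_integral => t _; rewrite patchE; have [t1|t1] := ltP t 1.
  by rewrite memNset /= ?in_itv/= ?andbT ?leNgt ?t1// ker1y_eq0// mul0e mule0.
rewrite mem_set /= ?in_itv/= ?andbT//; have t0 : 0 < t by exact: lt_le_trans t1.
rewrite muleA -EFinM ker1yE// -invfM -(IH (om \o lift ord0)) ?mulr_ge0 ?(ltW t0)//; last first.
  by move=> i; apply: om0.
congr iter_integral1y; apply: funext => u; congr EFin; congr (_ * _)^-1.
  by rewrite big_ord_recl tnth0 mulrA; congr (_ * _); apply: eq_bigr => i _; rewrite tnthS.
congr (_ `^ _); rewrite big_ord_recl tnth0 addrAC addrC [a + _]addrC; congr (_ + _).
by apply: eq_bigr => i _; rewrite tnthS.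
Qed.

Lemma I_integralE (r : nat) (om : 'I_r -> R) x a : (forall i, 0 < om i) ->
  I_integral x om a = Iw [seq om i | i <- enum 'I_r] x a.
Proof.
move=> om0; have := @iter_integral1yE r om x a 1 ler01 om0.
rewrite invr1 mul1e => <-; congr iter_integral1y.
by apply: funext => t; rewrite mul1r.
Qed.

End Iw_theory.

(** * Unrolling the recursion *)

Lemma cvg_contraction (R : realType) (q : R) (u w : nat -> R) :
  0 <= q < 1 -> (forall n, 0 <= u n) -> (forall n, u n.+1 <= q * u n + w n) ->
  w n @[n --> \oo] --> (0 : R) -> u n @[n --> \oo] --> (0 : R).
Proof.
move=> /andP[q0 q1] u0 uS w0.
have p0 : 0 < 1 - q by rewrite subr_gt0.
apply/cvgr0Pnorm_le => e e0.
have e2 : 0 < e / 2 by rewrite divr_gt0.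
(* With this threshold e/2 is the fixed point of y -> q y + (e/2)(1 - q), and the excess over it
   decays like q^j. *)
have /cvgr0Pnorm_le /(_ _ (mulr_gt0 e2 p0)) [N _ wN] := w0.
have bnd j : u (N + j)%N <= q ^+ j * u N + e / 2.
  elim: j => [|j IH]; first by rewrite addn0 expr0 mul1r lerDl ltW.
  rewrite addnS; apply: (le_trans (uS _)).
  have wj : w (N + j)%N <= e / 2 * (1 - q).
    by apply: (le_trans (ler_norm _)); apply: wN; rewrite /= leq_addr.
  apply: (le_trans (lerD (ler_wpM2l q0 IH) wj)).
  rewrite exprS le_eqVlt; apply/orP; left; apply/eqP; ring.
have qN : q ^+ j * u N @[j --> \oo] --> (0 : R).
  rewrite -[X in _ --> X](mul0r (u N)); apply: cvgM; last exact: cvg_cst.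
  by apply: cvg_expr; rewrite ger0_norm.
have /cvgr0Pnorm_le /(_ _ e2) [K _ qK] := qN.
exists (N + K)%N => // n /= NKn.
rewrite ger0_norm//; have -> : n = (N + (n - N))%N by lia.
apply: (le_trans (bnd _)).
rewrite [leRHS]splitr lerD2r; apply: (le_trans (ler_norm _)); apply: qK => /=; lia.
Qed.

(** * Sums over successive removals of elements *)

Section levels.
Variables (R : realType) (T : finType).
Implicit Types (phi : {set T} -> R) (V W : {set T}) (y : R).

(** The closed form of removing elements of [V] one at a time and stopping at [W]: there are |V \
    W|! orders of removal, each with a factor 1 / y per element. *)
Definition level_sum y phi V : R :=
  \sum_(W : {set T} | W \subset V) (#|V :\: W|)`!%:R / y ^+ #|V :\: W| * phi W.

(** A proper subset W of V lies in V minus i for exactly |V \ W| choices of i in V, which turns the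
    factorial of |V \ W| - 1 into that of |V \ W|. *)
Lemma level_sumE y phi V : y != 0 ->
  level_sum y phi V = phi V + y^-1 * \sum_(i in V) level_sum y phi (V :\ i).
Proof.
move=> y0; rewrite /level_sum (bigD1 V)//= setDv cards0 expr0 divr1 mul1r; congr (_ + _).
rewrite (exchange_big_dep (fun W => W \proper V))/=; last first.
  by move=> i W iV; rewrite subsetD1 properEneq => /andP[-> iW]; rewrite andbT;
     apply: contraNneq iW => ->.
rewrite mulr_sumr; apply: eq_big => [W|W /andP[WV nWV]].
  by rewrite properEneq andbC.
have card i : i \in V -> i \notin W -> #|V :\: W| = #|(V :\ i) :\: W|.+1.
  move=> iV iW; rewrite (cardsD1 i) inE iW iV add1n; congr _.+1.
  by apply: eq_card => j; rewrite !inE; do !case: (_ \in _); rewrite ?andbF ?andbT.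
rewrite (eq_bigr (fun=> (#|V :\: W|.-1)`!%:R / y ^+ #|V :\: W|.-1 * phi W)); last first.
  by move=> i /andP[iV]; rewrite subsetD1 => /andP[_ iW]; rewrite (card i).
rewrite (eq_bigl (mem (V :\: W))); last first.
  by move=> i; rewrite subsetD1 !inE WV/= andbC.
have WV' : W \proper V by rewrite properEneq nWV.
rewrite sumr_const; case E : #|V :\: W| => [|k]/=.
  move/eqP: E; rewrite cards_eq0 setD_eq0 => VW.
  by move: (WV'); rewrite properE VW andbF.
rewrite -mulr_natr factS natrM exprS invfM; ring.
Qed.

End levels.

(** * Normalized integrals and their truncations *)

Section normalized.
Variables (R : realType) (r : nat) (omega : 'I_r -> R) (a : R).
Hypotheses (omega_gt0 : forall i, 0 < omega i) (a_ge0 : 0 <= a).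
Implicit Types (V W : {set 'I_r}) (x : R).
Let tot : R := a + sum_on omega [set: 'I_r].
Hypothesis tot_gt0 : 0 < tot.

(** The coefficient of the exponent shift after normalization: the variables outside [W] are frozen
    at 1 and their weights belong to the constant term. *)
Definition ratio W : R := (a + sum_on omega (~: W)) / (a + sum_on omega [set: 'I_r]).

(* A^x times the integral over the variables indexed by V, the others being
   frozen at t_i = 1. *)
Definition nI x V : R :=
  (a + sum_on omega [set: 'I_r]) `^ x *
  fine (Iw [seq omega i | i <- enum V] x (a + sum_on omega (~: V))).

Lemma sum_on_ge0 V : 0 <= sum_on omega V.
Proof. by apply: sumr_ge0 => i _; exact: ltW. Qed.

Lemma sum_onC V : sum_on omega V + sum_on omega (~: V) = sum_on omega [set: 'I_r].
Proof.
rewrite /sum_on [RHS](bigID (mem V))/=; congr (_ + _); apply: eq_bigl => i;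
by rewrite !inE.
Qed.

Lemma ratio_ge0 W : 0 <= ratio W.
Proof. by rewrite divr_ge0 ?(ltW tot_gt0)// addr_ge0 ?sum_on_ge0. Qed.

Lemma ratio0 : ratio set0 = 1.
Proof. by rewrite /ratio setC0 divff ?gt_eqF. Qed.

Lemma ratio_lt1 W : W != set0 -> ratio W < 1.
Proof.
move=> /set0Pn[i iW]; rewrite ltr_pdivrMr// mul1r ltrD2l -(sum_onC W).
rewrite ltrDr /sum_on (bigD1 i)//= ltr_pwDl// sumr_ge0// => j _; exact: ltW.
Qed.

Lemma enum_fin_cond V : (0 < a + sum_on omega (~: V)) || (enum V != [::]).
Proof.
have [->|V0] := eqVneq V set0; first by rewrite setC0 tot_gt0.
apply/orP; right; apply: contraNneq V0 => E.
by rewrite -cards_eq0 cardE E.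
Qed.

Lemma rem_enum V i : rem i (enum V) = enum (V :\ i).
Proof.
rewrite rem_filter ?enum_uniq// /enum_mem -filter_predI; apply: eq_filter => j.
by rewrite !inE.
Qed.

Lemma sum_onCD1 V i : i \in V -> sum_on omega (~: (V :\ i)) = sum_on omega (~: V) + omega i.
Proof.
move=> iV; rewrite /sum_on (bigD1 i)/=; last by rewrite !inE eqxx.
rewrite addrC; congr (_ + _); apply: eq_bigl => j; rewrite !inE.
by have [->|] := eqVneq j i; rewrite ?iV ?andbF ?andbT.
Qed.

Lemma Iw_enum_fin x V : 0 < x ->
  Iw [seq omega i | i <- enum V] x (a + sum_on omega (~: V)) \is a fin_num.
Proof.
move=> x0; apply: Iw_fin_num => //; first exact: enum_uniq.
  by rewrite addr_ge0 ?sum_on_ge0.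
exact: enum_fin_cond.
Qed.

Lemma nI_ge0 x V : 0 <= nI x V.
Proof. by rewrite mulr_ge0 ?powR_ge0// fine_ge0// Iw_ge0. Qed.

Lemma nI_set0 x : nI x set0 = 1.
Proof.
rewrite /nI enum_set0/= setC0 powRN mulfV// gt_eqF// powR_gt0//.
Qed.

Lemma nI_rec x V : 0 < x ->
  nI x V = ratio V * nI (x + 1) V + x^-1 * \sum_(i in V) nI x (V :\ i).
Proof.
move=> x0; rewrite {1}/nI (Iw_rec omega_gt0) ?enum_uniq ?addr_ge0 ?sum_on_ge0 ?enum_fin_cond//.
have -> : (\sum_(i <- enum V) Iw [seq omega j | j <- rem i (enum V)] x (a + sum_on omega (~: V) + omega i) =
  (\sum_(i in V) fine (Iw [seq omega j | j <- enum (V :\ i)] x (a + sum_on omega (~: (V :\ i)))))%:E)%E.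
  rewrite big_enum/= -sumEFin; apply: eq_bigr => i iV.
  by rewrite rem_enum -addrA -sum_onCD1// fineK// Iw_enum_fin.
rewrite -[Iw _ (x + 1) _]fineK; last by rewrite Iw_enum_fin// addr_gt0.
rewrite -!EFinM -EFinD /= mulrDr; congr (_ + _).
  rewrite /nI /ratio -/tot powRD ?(gt_eqF tot_gt0) ?implybT// powRr1 ?(ltW tot_gt0)//.
  by field; rewrite gt_eqF.
by rewrite mulrCA; congr (_ * _); rewrite mulr_sumr.
Qed.

Lemma nI_le x V : 0 < x -> nI (x + 1) V <= nI x V.
Proof.
move=> x0; have x10 : 0 < x + 1 by rewrite addr_gt0.
rewrite /nI -/tot powRD ?(gt_eqF tot_gt0) ?implybT// powRr1 ?(ltW tot_gt0)// -mulrA.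
rewrite ler_wpM2l ?powR_ge0// -lee_fin EFinM !fineK ?Iw_enum_fin//.
apply: Iw_le => //.
- by apply/allP => v /mapP[i _ ->].
- by rewrite addr_ge0 ?sum_on_ge0.
- by rewrite big_map big_enum/= -addrA [X in _ + X]addrC sum_onC.
Qed.

(** [level_sum] exhausts the removals at the current exponent before x becomes x + 1. Where the
    unrolling stops, an integral over a nonempty set of variables is replaced by 0, while the one
    over no variables keeps its exact value 1. *)
Fixpoint trunc n x V : R :=
  if n is n'.+1 then level_sum x (fun W => ratio W * trunc n' (x + 1) W) V
  else (V == set0)%:R.

Lemma trunc_set0 n x : 0 < x -> trunc n x set0 = 1.
Proof.
elim: n x => [|n IH] x x0 /=; first by rewrite eqxx.
by rewrite level_sumE ?gt_eqF// big_set0 mulr0 addr0 ratio0 mul1r IH ?addr_gt0.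
Qed.

(** The bound must not depend on k, because step n + 1 at shift k refers to step n at shift k + 1.
    For nonempty V the errors obey a recursion with contraction factor [ratio V] < 1 and an
    inhomogeneous term from the sets V minus i, which tends to 0 by induction on |V|. *)
Lemma nI_trunc_bound x V : 0 < x -> exists e : nat -> R,
  e n @[n --> \oo] --> (0 : R) /\
  forall n k, `|nI (x + k%:R) V - trunc n (x + k%:R) V| <= e n.
Proof.
move=> x0; have [m] := ubnP #|V|; elim: m V => // m IH V Vm.
have xk k : 0 < x + k%:R by rewrite ltr_pwDl.
have [->|V0] := eqVneq V set0.
  exists (fun=> 0); split; first exact: cvg_cst.
  by move=> n k; rewrite nI_set0 trunc_set0// subrr normr0.
have /choice[e eP] : forall i, exists e : nat -> R, i \in V ->
    e n @[n --> \oo] --> (0 : R) /\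
    forall n k, `|nI (x + k%:R) (V :\ i) - trunc n (x + k%:R) (V :\ i)| <= e n.
  move=> i; have [iV|] := boolP (i \in V); last by exists (fun=> 0).
  have [|e eP] := IH (V :\ i); last by exists e.
  by move: Vm; rewrite (cardsD1 i) iV.
(* In [w] the factor 1 / (x + k) is replaced by its bound 1 / x, and the index is n + 1 because
   removals precede the exponent shift. The sequence [u] starts at [nI x V], which dominates every
   [nI (x + k) V] by [nI_le]. *)
pose w n := x^-1 * \sum_(i in V) e i n.+1.
pose u := fix u n := if n is n'.+1 then ratio V * u n' + w n' else nI x V.
have w0 n : 0 <= w n.
  rewrite mulr_ge0 ?invr_ge0 ?(ltW x0)// sumr_ge0// => i iV.
  have [_ /(_ n.+1 0)] := eP i iV; exact: le_trans.
exists u; split.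
  apply: (@cvg_contraction _ (ratio V) u w) => //.
  - by rewrite ratio_ge0 ratio_lt1.
  - by elim=> [|n un]; rewrite ?nI_ge0// addr_ge0// mulr_ge0 ?ratio_ge0.
  - rewrite -[X in _ --> X](mulr0 x^-1); apply: cvgM; first exact: cvg_cst.
    have E0 : \sum_(i in V) (0 : R) = 0 by rewrite big1.
    rewrite -[X in _ --> X]E0.
    apply: cvg_big; first exact: add_continuous.
    by move=> i iV; rewrite (cvg_shiftS (e i)); have [] := eP i iV.
elim=> [|n IHn] k.
  rewrite /= (negPf V0) subr0 ger0_norm ?nI_ge0//.
  elim: k => [|k]; first by rewrite addr0.
  by apply: le_trans; rewrite -natr1 addrA nI_le.
have -> : nI (x + k%:R) V - trunc n.+1 (x + k%:R) V =
    ratio V * (nI (x + k.+1%:R) V - trunc n (x + k.+1%:R) V) +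
    (x + k%:R)^-1 * \sum_(i in V)
      (nI (x + k%:R) (V :\ i) - trunc n.+1 (x + k%:R) (V :\ i)).
  rewrite nI_rec//= level_sumE ?gt_eqF// sumrB -natr1 !addrA; ring.
apply: (le_trans (ler_normD _ _)); rewrite [X in X + _]normrM [X in _ + X]normrM.
apply: lerD.
  by rewrite ger0_norm ?ratio_ge0// ler_wpM2l ?ratio_ge0.
rewrite /w ger0_norm ?invr_ge0 ?(ltW (xk _))//; apply: ler_pM; rewrite ?invr_ge0 ?(ltW (xk _))//.
  by rewrite lef_pV2 ?posrE// lerDl.
apply: (le_trans (ler_norm_sum _ _ _)); apply: ler_sum => i iV.
by have [] := eP i iV.
Qed.

Lemma trunc_cvg x V : 0 < x -> trunc n x V @[n --> \oo] --> nI x V.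
Proof.
move=> x0; have [e [e0 eP]] := nI_trunc_bound V x0.
apply/cvgrPdist_le => d d0.
move/cvgr0Pnorm_le : e0 => /(_ _ d0); apply: filterS => n.
apply: le_trans; rewrite (le_trans _ (ler_norm _))//.
by have := eP n 0%N; rewrite addr0.
Qed.

(** * The truncation as a sum over functions *)

Section functions.
Variables (x : R) (N : nat).
Local Notation M := N.+1.
Implicit Types f : {ffun 'I_r -> 'I_M}.

Definition fun_weight f (w : nat) : R :=
  (#|[set i | f i == w :> nat]%SET|)`!%:R / (x + w%:R) ^+ #|[set i | f i == w :> nat]%SET| *
  ratio [set i | (w < f i)%N]%SET.

(* min v (f i) = min v (f0 i) for all i says that f and f0 agree below level v. *)
Lemma trunc_funE_below n v (f0 : 'I_r -> nat) : (n + v = M)%N ->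
  trunc n (x + v%:R) [set i | (v <= f0 i)%N]%SET =
  \sum_(f : {ffun 'I_r -> 'I_M} | [forall i, minn v (f i) == minn v (f0 i)]) \prod_(v <= w < M) fun_weight f w.
Proof.
elim: n v f0 => [|n IH] v f0 /=.
  rewrite add0n => ->; under eq_bigr do rewrite big_geq//.
  (* An index with f0 >= M admits no f with values at most N, so the sum is empty; this matches the
     value 0 of [trunc 0] on a nonempty set. *)
  have [/eqP V0|/set0Pn[i]] := boolP (_ == _ :> {set _}); last first.
    rewrite inE => Mi; rewrite big_pred0// => f; apply/negbTE/forallPn; exists i.
    by have := ltn_ord (f i); lia.
  have f0M i : (f0 i < M)%N.
    by rewrite ltnNge; apply/negP => Mi; have := in_set0 i; rewrite -V0 inE Mi.
  rewrite (big_pred1 [ffun i => Ordinal (f0M i)])// => f; rewrite /=.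
  apply/forallP/eqP => [H|-> i]; last by rewrite ffunE.
  apply/ffunP => i; rewrite ffunE; apply/val_inj => /=.
  by have := H i; have := f0M i; have := ltn_ord (f i); lia.
move=> nv; set V := [set i | _]%SET.
rewrite (partition_big (fun f => [set i | (v < f i)%N]%SET) (fun W => W \subset V))/=; last first.
  move=> f /forallP Hf; apply/fintype.subsetP => i; rewrite !inE.
  by have := Hf i; lia.
apply: eq_bigr => W WV.
(* The prescription extended to level v: elements of V outside W receive the value v, and those of W
   the value M, which stands for any value above v. *)
pose f1 i := if i \in W then M else if i \in V then v else f0 i.
have VE i : (i \in V) = (v <= f0 i)%N by rewrite inE.
have WE : W = [set i | (v.+1 <= f1 i)%N]%SET.
  apply/setP => i; rewrite inE /f1; case: ifP => [|iW]; first by lia.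
  by case: ifPn; rewrite VE; lia.
rewrite -addrA natr1 [in trunc _ _ _]WE IH; last by lia.
rewrite mulrA mulr_sumr; apply: eq_big => [f|f].
  apply/forallP/andP => [H|[/forallP H /eqP WfE] i].
    split; first apply/forallP => i.
      have := H i; rewrite /f1; case: ifPn => [/(fintype.subsetP WV)|_]; first by rewrite VE; lia.
      by case: ifPn; rewrite VE; lia.
    apply/eqP/setP => i; rewrite inE; have := H i; rewrite /f1.
    by case: ifPn => iW; [|case: ifPn; rewrite VE]; lia.
  have := H i; have : (i \in W) = (v < f i)%N by rewrite -WfE inE.
  by rewrite /f1; case: (i \in W) => /= /esym; [|case: ifPn; rewrite VE]; lia.
move=> /forallP H; rewrite [in RHS]big_ltn; last by lia.
congr (_ * _); rewrite /fun_weight.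
have -> : [set i | f i == v :> nat]%SET = V :\: W.
  apply/setP => i; rewrite !inE; have := H i; rewrite /f1 VE.
  by case: (i \in W) => /=; [|case: ifPn]; lia.
have -> // : [set i | (v < f i)%N]%SET = W.
apply/setP => i; rewrite !inE; have := H i; rewrite /f1 VE.
by case: (i \in W) => /=; [|case: ifPn]; lia.
Qed.

Lemma trunc_funE : trunc M x [set: 'I_r] = \sum_(f : {ffun 'I_r -> 'I_M}) \prod_(w < M) fun_weight f w.
Proof.
have := @trunc_funE_below M 0 (fun=> 0%N); rewrite addn0 addr0 => /(_ erefl).
have -> : [set i : 'I_r | (0 <= 0)%N]%SET = [set: 'I_r]%SET by apply/setP => i; rewrite !inE.
move=> ->; apply: eq_big => [f|f _]; last by rewrite big_mkord.
by apply/forallP => i; rewrite !min0n.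
Qed.

End functions.
End normalized.

(** * Functions and their level sets *)

Lemma sum_partition_nat (R : nmodType) (I : finType) (P : pred I) (F : I -> R)
    (p : I -> nat) (a b : nat) : (forall i, P i -> (a <= p i < b)%N) ->
  \sum_(i | P i) F i = \sum_(a <= t < b) \sum_(i | P i && (p i == t)) F i.
Proof.
move=> Pp; rewrite (exchange_big_dep P)/=; last by move=> t i _ /andP[].
apply: eq_bigr => i Pi; rewrite (eq_bigl (fun t => t == p i)); last first.
  by move=> t; rewrite Pi eq_sym.
by rewrite big_nat1_eq Pp.
Qed.

Section values.
Variables (r N : nat).
Local Notation M := N.+1.
Implicit Types (f : {ffun 'I_r -> 'I_M}) (s t : nat).

Definition supp f : nat := #|[set i | (0 < f i)%N]%SET|.

Definition vals f : seq 'I_M := [seq v : 'I_M <- enum 'I_M | (0 < v)%N && [exists i, f i == v]].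

Lemma mem_vals f v : (v \in vals f) = (0 < v)%N && [exists i, f i == v].
Proof. by rewrite mem_filter mem_enum andbT. Qed.

Lemma vals_uniq f : uniq (vals f).
Proof. by rewrite filter_uniq// enum_uniq. Qed.

Lemma vals_sorted f : sorted (fun u v : 'I_M => (u < v)%N) (vals f).
Proof.
apply: sorted_filter; first by move=> u v w; exact: ltn_trans.
have := iota_ltn_sorted 0 M; rewrite -val_enum_ord sorted_map.
by apply: sub_sorted.
Qed.

Lemma size_vals_le f : (size (vals f) <= supp f)%N.
Proof.
rewrite -(card_uniqP (vals_uniq f)) /supp.
apply: leq_trans (leq_imset_card f _); apply/subset_leq_card/fintype.subsetP => v.
rewrite mem_vals => /andP[v0 /existsP[i /eqP fi]]; apply/imsetP; exists i => //.
by rewrite inE fi.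
Qed.

Lemma size_vals_gt0 f : (0 < supp f)%N -> (0 < size (vals f))%N.
Proof.
move=> /card_gt0P[i]; rewrite inE => fi.
have : f i \in vals f by rewrite mem_vals fi/=; apply/existsP; exists i.
by case: (vals f).
Qed.

Variable s : nat.
Implicit Types (p : {ffun 'I_s -> {set 'I_r}} * {ffun 'I_s -> 'I_M}).

(** Together with [fun_to_blocks], the dictionary between f and its positive levels with their level
    sets. An index in no block is sent to 0, so K_0 stays implicit. *)
Definition blocks_to_fun p : {ffun 'I_r -> 'I_M} :=
  [ffun i => if [pick j | i \in p.1 j] is Some j then p.2 j else ord0].

Definition fun_to_blocks f : {ffun 'I_s -> {set 'I_r}} * {ffun 'I_s -> 'I_M} :=
  ([ffun j : 'I_s => [set i | f i == nth ord0 (vals f) j]%SET],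
   [ffun j : 'I_s => nth ord0 (vals f) j]).

Definition nonempty_disjoint (K : {ffun 'I_s -> {set 'I_r}}) : bool :=
  [forall i, K i != set0] && [forall i, forall j, (i != j) ==> [disjoint K i & K j]].

Lemma blocks_to_funK f : size (vals f) = s -> blocks_to_fun (fun_to_blocks f) = f.
Proof.
move=> fs; apply/ffunP => i; rewrite !ffunE; case: pickP => [j|nj].
  by rewrite !ffunE inE => /eqP <-.
apply/val_inj => /=; case: (posnP (f i)) => // fi.
have fiv : f i \in vals f by rewrite mem_vals fi/=; apply/existsP; exists i.
have js : (index (f i) (vals f) < s)%N by rewrite -fs index_mem.
by have := nj (Ordinal js); rewrite !ffunE inE nth_index// eqxx.
Qed.

Lemma fun_to_blocks_valid f : size (vals f) = s ->
  nonempty_disjoint (fun_to_blocks f).1 && strict_indices (fun_to_blocks f).2.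
Proof.
move=> fs.
have sz (j : 'I_s) : (j < size (vals f))%N by rewrite fs.
have mv (j : 'I_s) : nth ord0 (vals f) j \in vals f by rewrite mem_nth.
apply/andP; split; apply/andP; split; apply/forallP => j; rewrite ?ffunE.
- have := mv j; rewrite mem_vals => /andP[_ /existsP[i fi]].
  by apply/set0Pn; exists i; rewrite inE.
- apply/forallP => j'; apply/implyP => jj'; rewrite !ffunE -setI_eq0.
  apply/eqP/setP => i; rewrite !inE; apply/negP => /andP[/eqP-> /eqP/(uniqP ord0 (vals_uniq f))].
  by rewrite !inE !sz => /(_ isT isT) /val_inj /eqP; rewrite (negPf jj').
- by have := mv j; rewrite mem_vals => /andP[].
- apply/forallP => j'; apply/implyP => jj'; rewrite !ffunE.
  apply: (sorted_ltn_nth _ ord0 (vals_sorted f)) => //; rewrite ?inE ?sz//.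
  by move=> u v w; exact: ltn_trans.
Qed.

Section valid.
Variables (K : {ffun 'I_s -> {set 'I_r}}) (n : {ffun 'I_s -> 'I_M}).
Hypotheses (Kd : nonempty_disjoint K) (nd : strict_indices n).
Let f := blocks_to_fun (K, n).

Lemma strict_gt0 (j : 'I_s) : (0 < n j)%N.
Proof. by have /andP[/forallP/(_ j)] := nd. Qed.

Lemma strict_lt (i j : 'I_s) : (i < j)%N -> (n i < n j)%N.
Proof. by have /andP[_ /forallP/(_ i)/forallP/(_ j)/implyP] := nd. Qed.

Lemma strict_inj : injective n.
Proof.
move=> i j nij; apply/val_inj => /=.
case: (ltngtP i j) => // /strict_lt; by rewrite nij ltnn.
Qed.

Lemma disjoint_mem_eq (i : 'I_r) (j j' : 'I_s) : i \in K j -> i \in K j' -> j = j'.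
Proof.
move=> ij ij'; apply/eqP; apply: contraLR ij' => jj'.
have /andP[_ /forallP/(_ j)/forallP/(_ j')/implyP/(_ jj')] := Kd.
by move=> /disjointFr ->.
Qed.

Lemma blocks_to_fun_in (i : 'I_r) (j : 'I_s) : i \in K j -> f i = n j.
Proof.
move=> ij; rewrite ffunE/=; case: pickP => [j' ij'|/(_ j)]; last by rewrite ij.
by rewrite (disjoint_mem_eq ij ij').
Qed.

Lemma blocks_to_fun_notin i : i \notin (\bigcup_j K j)%SET -> f i = ord0.
Proof.
move=> iK; rewrite ffunE/=; case: pickP => // j ij; case/negP: iK.
by apply/bigcupP; exists j.
Qed.

Lemma blocks_to_fun_eq (i : 'I_r) (j : 'I_s) : (f i == n j) = (i \in K j).
Proof.
apply/eqP/idP => [|/blocks_to_fun_in//].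
have [/bigcupP[j' _ ij']|/blocks_to_fun_notin ->] := boolP (i \in (\bigcup_j K j)%SET).
  by rewrite (blocks_to_fun_in ij') => /strict_inj <-.
by move=> /(congr1 val)/= n0; have := strict_gt0 j; rewrite -n0.
Qed.

Lemma blocks_to_fun_eq0 i : (f i == 0%N :> nat) = (i \notin (\bigcup_j K j)%SET).
Proof.
have [/bigcupP[j _ ij]|/blocks_to_fun_notin ->//] := boolP (i \in (\bigcup_j K j)%SET).
by rewrite (blocks_to_fun_in ij) eqn0Ngt strict_gt0.
Qed.

(** Both lists are strictly increasing, and they have the same members because every n_j is attained
    on its nonempty block. *)
Lemma vals_blocks_to_fun : vals f = [seq n j | j <- enum 'I_s].
Proof.
have tr : transitive (fun u v : 'I_M => (u < v)%N) by move=> u v w; exact: ltn_trans.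
apply: (irr_sorted_eq tr); first by move=> u; exact: ltnn.
- exact: vals_sorted.
- rewrite sorted_map; have := iota_ltn_sorted 0 s; rewrite -val_enum_ord sorted_map.
  by apply: sub_sorted => i j; exact: strict_lt.
- move=> v; rewrite mem_vals; apply/andP/mapP => [[v0 /existsP[i /eqP fi]]|[j _ ->]].
    have iK : i \in (\bigcup_j K j)%SET by rewrite -[_ \in _]negbK -blocks_to_fun_eq0 fi -lt0n.
    by move/bigcupP : iK => [j _ ij]; exists j; rewrite ?mem_enum// -fi (blocks_to_fun_in ij).
  split; first exact: strict_gt0.
  have /andP[/forallP/(_ j)/set0Pn[i ij] _] := Kd.
  by apply/existsP; exists i; rewrite (blocks_to_fun_in ij).
Qed.

Lemma size_vals_blocks_to_fun : size (vals f) = s.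
Proof. by rewrite vals_blocks_to_fun size_map size_enum_ord. Qed.

Lemma nth_vals_blocks_to_fun (j : 'I_s) : nth ord0 (vals f) j = n j.
Proof.
by rewrite vals_blocks_to_fun (nth_map j) ?size_enum_ord// nth_ord_enum.
Qed.

Lemma fun_to_blocksK : fun_to_blocks f = (K, n).
Proof.
congr (_, _); apply/ffunP => j; rewrite ffunE nth_vals_blocks_to_fun//.
by apply/setP => i; rewrite inE blocks_to_fun_eq.
Qed.

Lemma card_bigcup : #|(\bigcup_j K j)%SET| = (\sum_j #|K j|)%N.
Proof.
rewrite -sum1_card partition_disjoint_bigcup/=; last first.
  by move=> j j' jj'; have /andP[_ /forallP/(_ j)/forallP/(_ j')/implyP/(_ jj')] := Kd.
by apply: eq_bigr => j _; rewrite sum1_card.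
Qed.

Lemma supp_blocks_to_fun : supp f = (\sum_j #|K j|)%N.
Proof.
rewrite -card_bigcup /supp; apply: eq_card => i.
by rewrite inE lt0n blocks_to_fun_eq0 negbK.
Qed.

End valid.

Lemma sum_blocks (R : nmodType) t (F : {ffun 'I_r -> 'I_M} -> R) :
  \sum_(f | (supp f == t) && (size (vals f) == s)) F f =
  \sum_(K | nonempty_disjoint K && (\sum_j #|K j| == t)%N)
    \sum_(n | strict_indices n) F (blocks_to_fun (K, n)).
Proof.
rewrite (reindex_onto blocks_to_fun fun_to_blocks)/=; last first.
  by move=> f /andP[_ /eqP]; exact: blocks_to_funK.
rewrite [RHS]pair_big_dep /=; apply: eq_big => [[K n]|[K n] _]//=.
apply/andP/andP => [[/andP[/eqP st /eqP vs] /eqP E]|[/andP[Kd /eqP st] nd]].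
  have := fun_to_blocks_valid vs; rewrite E => /andP[Kd nd].
  by rewrite Kd nd -(supp_blocks_to_fun Kd nd) st eqxx.
by rewrite (supp_blocks_to_fun Kd nd) st (size_vals_blocks_to_fun Kd nd) fun_to_blocksK// !eqxx.
Qed.

End values.

(** * Series *)

Section series_lemmas.
Variable R : realType.
Implicit Types (u v b : nat -> R).

Lemma series_tail_le u b (U B : R) K : (forall L, `|u L| <= b L) ->
  series u @ \oo --> U -> series b @ \oo --> B ->
  `|U - series u K| <= B - series b K.
Proof.
move=> ub uU bB.
have c1 : `|series u n - series u K| @[n --> \oo] --> `|U - series u K|.
  by apply: cvg_norm; apply: cvgB => //; exact: cvg_cst.
have c2 : series b n - series b K @[n --> \oo] --> B - series b K.
  by apply: cvgB => //; exact: cvg_cst.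
apply: (ler_cvg_to c1 c2); exists K => // n /= Kn.
rewrite !sub_series_geq//; apply: (le_trans (ler_norm_sum _ _ _)).
by apply: ler_sum => L _; apply: ub.
Qed.

(** Dominated convergence for series: a cut at K where the tail of [b] is small controls the tails
    of [v] and of all [u^~ N] at once. The common limit is only asserted to exist, so neither side
    needs to be known in advance. *)
Lemma tannery (u : nat -> nat -> R) v b (E : nat -> R) :
  (forall L N, `|u L N| <= b L) -> cvgn (series b) ->
  (forall L, u L N @[N --> \oo] --> v L) ->
  (forall N, series (u^~ N) @ \oo --> E N) ->
  exists2 l : R, series v @ \oo --> l & E N @[N --> \oo] --> l.
Proof.
move=> ub cb uv uE.
have vb L : `|v L| <= b L.
  apply: (ler_cvg_to (cvg_norm (uv L)) (cvg_cst (b L))).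
  by exists 0%N => // N _; apply: ub.
have cv : cvgn (series v).
  apply: normed_cvg; apply: (series_le_cvg _ _ vb cb) => n; first exact: normr_ge0.
  exact: le_trans (vb n).
exists (limn (series v)) => //.
apply/cvgrPdist_le => e e0.
have e3 : 0 < e / 3 by rewrite divr_gt0.
have [K _ bK] : \forall K \near \oo, limn (series b) - series b K <= e / 3.
  move/cvgrPdist_le : (cb : series b @ \oo --> limn (series b)) => /(_ _ e3).
  by apply: filterS => n; apply: le_trans; exact: ler_norm.
have {bK} bK := bK K (leqnn K).
have uK : series (u^~ N) K @[N --> \oo] --> series v K.
  rewrite /series/=; apply: cvg_big; first exact: add_continuous.
  by move=> L _; exact: uv.
move/cvgrPdist_le : uK => /(_ _ e3); apply: filterS => N uK.
have t1 := series_tail_le K (ub^~ N) (uE N) cb.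
have t2 := series_tail_le K vb cv cb.
have -> : limn (series v) - E N = (limn (series v) - series v K) +
  (series v K - series (u^~ N) K) - (E N - series (u^~ N) K) by ring.
apply: (le_trans (ler_normB _ _)).
have -> : e = e / 3 + e / 3 + e / 3 by field.
apply: lerD; last exact: le_trans bK.
apply: (le_trans (ler_normD _ _)); apply: lerD => //; exact: le_trans bK.
Qed.

Lemma cvg_prod_ord (s : nat) (f : 'I_s -> nat -> R) (l : 'I_s -> R) :
  (forall i, f i n @[n --> \oo] --> l i) ->
  \prod_i f i n @[n --> \oo] --> \prod_i l i.
Proof. by move=> fl; apply: cvg_big => //; exact: mul_continuous. Qed.

Lemma nonneg_bounded_series u B : (forall n, 0 <= u n) ->
  (forall n, series u n <= B) -> cvgn (series u).
Proof.
move=> u0 uB; apply: nondecreasing_is_cvgn; first exact: nondecreasing_series.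
by exists B => _ [n _ <-].
Qed.

(** The l-th term of the expansion of (1 - y)^-(k+1); the exponent is shifted by one so that k = 0
    is the geometric series. *)
Definition negbin_coef (k : nat) (y : R) (l : nat) : R := 'C(k + l, k)%:R * y ^+ l.

(** Pascal's rule: multiplication by 1 - y lowers k by one, up to a boundary term at the cut. *)
Lemma negbin_partial k y M : (1 - y) * series (negbin_coef k.+1 y) M =
  series (negbin_coef k y) M - 'C(k + M, k.+1)%:R * y ^+ M.
Proof.
elim: M => [|M IH].
  by rewrite /series/= !big_geq// mulr0 addn0 bin_small// mul0r subr0.
rewrite !seriesSr mulrDr IH /negbin_coef addSn binS addnS binS !natrD exprS; ring.
Qed.

Lemma negbin_coef_ge0 k y l : 0 <= y -> 0 <= negbin_coef k y l.
Proof. by move=> y0; rewrite mulr_ge0 ?ler0n ?exprn_ge0. Qed.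

Lemma negbin_cvg_nonneg k y : 0 <= y -> y < 1 -> cvgn (series (negbin_coef k y)).
Proof.
move=> y0 y1; elim: k => [|k IH].
  have -> : negbin_coef 0 y = geometric 1 y.
    by apply: funext => l; rewrite /negbin_coef bin0.
  by apply: is_cvg_geometric_series; rewrite ger0_norm.
have p0 : 0 < 1 - y by rewrite subr_gt0.
apply: (@nonneg_bounded_series _ (limn (series (negbin_coef k y)) / (1 - y))).
  by move=> n; exact: negbin_coef_ge0.
move=> n; rewrite ler_pdivlMr// mulrC negbin_partial.
apply: (@le_trans _ _ (series (negbin_coef k y) n)).
  by rewrite gerBl mulr_ge0 ?ler0n ?exprn_ge0.
apply: nondecreasing_cvgn_le => //; apply: nondecreasing_series => l _ _.
exact: negbin_coef_ge0.
Qed.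

Lemma negbin_norm k y : (fun l => `|negbin_coef k y l|) = negbin_coef k `|y|.
Proof.
by apply: funext => l; rewrite /negbin_coef normrM normr_nat normrX.
Qed.

Lemma negbin_series k y : `|y| < 1 ->
  series (negbin_coef k y) @ \oo --> (1 - y) ^- k.+1.
Proof.
move=> y1; have yn1 : 1 - y != 0.
  by rewrite subr_eq0; apply: contraTneq y1 => <-; rewrite normr1 ltxx.
elim: k => [|k IH].
  have -> : negbin_coef 0 y = geometric 1 y.
    by apply: funext => l; rewrite /negbin_coef bin0.
  by have := @cvg_geometric_series _ (1 : R) y y1; rewrite mul1r.
have -> : series (negbin_coef k.+1 y) =
    fun M => (series (negbin_coef k y) M - 'C(k + M, k.+1)%:R * y ^+ M) / (1 - y).
  by apply: funext => M; rewrite -negbin_partial mulrC mulKf.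
rewrite exprSr invfM; apply: cvgM; last exact: cvg_cst.
rewrite -[X in _ --> X]subr0; apply: cvgB => //.
(* The boundary term is bounded by the M-th term of the series for k + 1 at |y|, since C(k+M, k+1)
   <= C(k+1+M, k+1). That series converges by the nonnegative case, so its terms tend to 0. *)
have := cvg_series_cvg_0 (@negbin_cvg_nonneg k.+1 _ (normr_ge0 y) y1).
move=> /cvgr0Pnorm_le c0; apply/cvgr0Pnorm_le => e e0.
move: (c0 e e0); apply: filterS => M; apply: le_trans.
rewrite /negbin_coef !normrM !normr_nat !normrX normr_id ler_wpM2r ?exprn_ge0//.
by rewrite ler_nat addSn binS leq_addr.
Qed.

(** Here (n + x)^-k = n^-k (1 - (-x/n))^-k with x/n < 1, because x < 1 <= n. Absolute convergence is
    recorded for the Cauchy product. *)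
Lemma inv_pow_series (k n : nat) (x : R) : 0 < x -> x < 1 -> (0 < k)%N -> (0 < n)%N ->
  let t l := 'C(k + l - 1, l)%:R * (- x) ^+ l / n%:R ^+ (k + l) in
  cvgn (series (fun l => `|t l|)) /\ series t @ \oo --> (n%:R + x) ^- k.
Proof.
move=> x0 x1 k0 n0 t; case: k k0 @t => // k _ t.
have n00 : 0 < n%:R :> R by rewrite ltr0n.
have yn : `|- x / n%:R| < 1.
  rewrite normrM normrN normfV normr_nat gtr0_norm// ltr_pdivrMr// mul1r.
  by rewrite (lt_le_trans x1)// ler1n.
have tE : t = (fun l => n%:R ^- k.+1 * negbin_coef k (- x / n%:R) l).
  apply: funext => l; rewrite /t /negbin_coef addSn subn1/= -bin_sub ?leq_addl// addnK.
  by rewrite -addSn exprD expr_div_n; field; rewrite ?expf_neq0 ?gt_eqF.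
have serE c u : series (fun l => c * u l) = fun M => c * series u M.
  by apply: funext => M; rewrite /series/= mulr_sumr.
split; last first.
  rewrite tE serE.
  have -> : (n%:R + x) ^- k.+1 = n%:R ^- k.+1 * (1 - (- x / n%:R)) ^- k.+1.
    rewrite -invfM -exprMn; congr (_ ^+ _)^-1; by field; rewrite gt_eqF.
  by apply: cvgM; [exact: cvg_cst|exact: negbin_series].
rewrite tE; under eq_fun do rewrite normrM.
rewrite serE; apply: is_cvgM; first exact: is_cvg_cst.
rewrite negbin_norm; apply: negbin_cvg_nonneg => //.
Qed.

End series_lemmas.

(** * Cauchy products of finitely many series *)

Section multi_index.
Variables (R : realType) (s : nat).

Definition ord_fun (M : nat) (l : {ffun 'I_s -> 'I_M}) : 'I_s -> nat :=
  fun i => l i.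

(** The index type depends on the bound, so sums with different bounds become comparable only once
    both are moved into the larger type. *)
Lemma sum_ffun_widen (P : pred ('I_s -> nat)) (F : ('I_s -> nat) -> R) (a b : nat) :
  (a <= b)%N ->
  \sum_(l : {ffun 'I_s -> 'I_a.+1} | P (ord_fun l)) F (ord_fun l) =
  \sum_(l : {ffun 'I_s -> 'I_b.+1} | P (ord_fun l) && [forall i, (l i < a.+1)%N])
     F (ord_fun l).
Proof.
move=> ab; have ab1 : (a.+1 <= b.+1)%N by [].
pose h (l : {ffun 'I_s -> 'I_a.+1}) : {ffun 'I_s -> 'I_b.+1} :=
  [ffun i => widen_ord ab1 (l i)].
pose h' (l : {ffun 'I_s -> 'I_b.+1}) : {ffun 'I_s -> 'I_a.+1} := [ffun i => inord (l i)].
have hE l : ord_fun (h l) = ord_fun l by apply: funext => i; rewrite /ord_fun ffunE.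
rewrite [RHS](reindex_onto h h'); last first.
  move=> l /andP[_ /forallP la]; apply/ffunP => i; rewrite !ffunE.
  by apply/val_inj => /=; rewrite inordK.
apply: eq_big => [l|l _]; rewrite hE//.
have -> : h' (h l) == l.
  by apply/eqP/ffunP => i; rewrite !ffunE; apply/val_inj; rewrite /= inordK.
have ha : [forall i, (h l i < a.+1)%N] by apply/forallP => i; rewrite ffunE /=.
by rewrite ha !andbT.
Qed.

Definition antidiag (u : 'I_s -> nat -> R) (L : nat) : R :=
  \sum_(l : {ffun 'I_s -> 'I_L.+1} | (\sum_(i < s) l i == L)%N) \prod_(i < s) u i (l i).

Lemma le_sum_ord (l : 'I_s -> nat) (i : 'I_s) : (l i <= \sum_(j < s) l j)%N.
Proof. by rewrite (bigD1 i)//= leq_addr. Qed.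

Lemma antidiag_series (u : 'I_s -> nat -> R) M : series (antidiag u) M.+1 =
  \sum_(l : {ffun 'I_s -> 'I_M.+1} | (\sum_(i < s) l i < M.+1)%N) \prod_(i < s) u i (l i).
Proof.
rewrite /series/= big_mkord.
rewrite [RHS](partition_big (fun l : {ffun 'I_s -> 'I_M.+1} => inord (\sum_(i < s) l i) : 'I_M.+1) predT)//=.
apply: eq_bigr => L _; have LM : (L <= M)%N by rewrite -ltnS.
rewrite /antidiag (sum_ffun_widen (fun m => \sum_(i < s) m i == L)%N
  (fun m => \prod_(i < s) u i (m i)) LM).
apply: eq_bigl => l; rewrite /ord_fun; apply/andP/andP => [[/eqP lL _]|[lM /eqP <-]].
  split; first by rewrite lL.
  by apply/eqP/val_inj; rewrite /= lL inordK.
rewrite inordK//; split=> //; apply/forallP => i; rewrite ltnS.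
exact: (le_sum_ord (ord_fun l)).
Qed.

Lemma box_series (u : 'I_s -> nat -> R) M : \prod_(i < s) series (u i) M.+1 =
  \sum_(l : {ffun 'I_s -> 'I_M.+1}) \prod_(i < s) u i (l i).
Proof. by rewrite -(bigA_distr_bigA (fun i (j : 'I_M.+1) => u i j)); apply: eq_bigr => i _; rewrite /series/= big_mkord. Qed.

Hypothesis s_gt0 : (0 < s)%N.

(** The cube of side M / s, rounded down, lies in the simplex where the l_i sum to at most M. *)
Lemma box_le_antidiag (u : 'I_s -> nat -> R) M : (forall i l, 0 <= u i l) ->
  \prod_(i < s) series (u i) ((M %/ s).+1) <= series (antidiag u) M.+1.
Proof.
move=> u0; rewrite box_series antidiag_series.
have F0 m : 0 <= \prod_(i < s) u i (m i) by apply: prodr_ge0.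
rewrite (sum_ffun_widen predT (fun m => \prod_(i < s) u i (m i)) (leq_div M s)).
rewrite /= big_mkcond [leRHS]big_mkcond /=; apply: ler_sum => l _.
case: ifPn => [/forallP ls|_]; last by case: ifP => // _; exact: F0.
rewrite ifT//; rewrite ltnS; apply: leq_trans (leq_trunc_div M s).
rewrite -[X in (_ * X)%N](card_ord s) mulnC -sum_nat_const; apply: leq_sum => i _.
by rewrite -ltnS.
Qed.

(** For absolute values the simplex sum is squeezed between the cubes of sides M / s and M, whose
    sums have the same limit. For signed terms the difference between cube and simplex is bounded by
    the same difference for the absolute values. *)
Lemma multi_cauchy_product (u : 'I_s -> nat -> R) (U : 'I_s -> R) :
  (forall i, cvgn (series (fun l => `|u i l|))) -> (forall i, series (u i) @ \oo --> U i) ->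
  series (antidiag u) @ \oo --> \prod_(i < s) U i.
Proof.
move=> cu uU; rewrite -(cvg_shiftS (series (antidiag u))).
pose p i l := `|u i l|.
have p0 i l : 0 <= p i l by exact: normr_ge0.
pose P := \prod_(i < s) limn (series (p i)).
have boxp : \prod_(i < s) series (p i) M @[M --> \oo] --> P by apply: cvg_prod_ord.
have boxp1 : \prod_(i < s) series (p i) M.+1 @[M --> \oo] --> P.
  by rewrite (cvg_shiftS (fun M => \prod_(i < s) series (p i) M)).
have boxu : \prod_(i < s) series (u i) M.+1 @[M --> \oo] --> \prod_(i < s) U i.
  rewrite (cvg_shiftS (fun M => \prod_(i < s) series (u i) M)).
  exact: cvg_prod_ord.
have divoo : (M %/ s).+1 @[M --> \oo] --> \oo.
  move=> A [K _ KA]; exists (K * s)%N => // n /= Kn; apply: KA => /=.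
  by apply: leqW; rewrite leq_divRL.
have boxd : \prod_(i < s) series (p i) ((M %/ s).+1) @[M --> \oo] --> P.
  exact: (@cvg_comp _ _ _ (fun M => (M %/ s).+1)
    (fun M => \prod_(i < s) series (p i) M) _ _ _ divoo boxp).
have anti_le M : series (antidiag p) M.+1 <= \prod_(i < s) series (p i) M.+1.
  rewrite antidiag_series box_series [leLHS]big_mkcond/=; apply: ler_sum => l _.
  by case: ifP => // _; apply: prodr_ge0.
have antip : series (antidiag p) M.+1 @[M --> \oo] --> P.
  apply: (squeeze_cvgr _ boxd boxp1); exists 0%N => // M _.
  by rewrite anti_le box_le_antidiag.
have diff0 : \prod_(i < s) series (p i) M.+1 - series (antidiag p) M.+1 @[M --> \oo] --> (0 : R).
  by rewrite -[X in _ --> X](subrr P); apply: cvgB.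
have d0 : \prod_(i < s) series (u i) M.+1 - series (antidiag u) M.+1 @[M --> \oo] --> (0 : R).
  apply/cvgr0Pnorm_le => e e0; move/cvgr0Pnorm_le : diff0 => /(_ _ e0).
  apply: filterS => M; apply: le_trans; rewrite [leRHS]ger0_norm ?subr_ge0 ?anti_le//.
  rewrite !box_series !antidiag_series.
  rewrite [X in `|X - _|](bigID (fun l : {ffun 'I_s -> 'I_M.+1} => \sum_(i < s) l i < M.+1)%N)/=.
  rewrite [X in _ <= X - _](bigID (fun l : {ffun 'I_s -> 'I_M.+1} => \sum_(i < s) l i < M.+1)%N)/=.
  rewrite [X in `|X|]addrAC subrr add0r [leRHS]addrAC subrr add0r.
  apply: (le_trans (ler_norm_sum _ _ _)); apply: ler_sum => l _.
  by rewrite normr_prod.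
rewrite (_ : (fun M => series (antidiag u) M.+1) = (fun M => \prod_(i < s) series (u i) M.+1 -
    (\prod_(i < s) series (u i) M.+1 - series (antidiag u) M.+1))); last first.
  by apply: funext => M; rewrite opprB addrC subrK.
by have := cvgB boxu d0; rewrite subr0; exact.
Qed.

End multi_index.

(** * Multiple polylogarithms and their shifted sums *)

Section multi_polylog.
Variables (R : realType) (s : nat).
Hypothesis s_gt0 : (0 < s)%N.
Implicit Types (z : 'I_s -> R) (k : 'I_s -> nat).

(** The condition of [strict_indices] freed of the bound on the values, in the form that
    [sum_ffun_widen] takes. *)
Definition strict_fun (n : 'I_s -> nat) : bool :=
  [forall i : 'I_s, (0 < n i)%N]
  && [forall i : 'I_s, forall j : 'I_s, (i < j)%N ==> (n i < n j)%N].

Definition strict_sum (F : ('I_s -> nat) -> R) (N : nat) : R :=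
  \sum_(n : {ffun 'I_s -> 'I_N.+1} | strict_indices n) F (ord_fun n).

Definition polylog_term k z (n : 'I_s -> nat) : R :=
  \prod_(i < s) (z i ^+ n i / (n i)%:R ^+ k i).

Lemma strict_sum_nondecreasing F : (forall n, 0 <= F n) ->
  nondecreasing_seq (strict_sum F).
Proof.
move=> F0; apply/nondecreasing_seqP => N; rewrite /strict_sum.
change (\sum_(n : {ffun 'I_s -> 'I_N.+1} | strict_fun (ord_fun n)) F (ord_fun n) <=
  \sum_(n : {ffun 'I_s -> 'I_N.+2} | strict_fun (ord_fun n)) F (ord_fun n)).
rewrite (sum_ffun_widen strict_fun F (leqnSn N)).
rewrite [leLHS]big_mkcond [leRHS]big_mkcond /=; apply: ler_sum => n _.
by case: (strict_fun _); case: [forall i, _]; rewrite ?F0.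
Qed.

(** Dropping the order of the indices leaves a product of geometric series. The bound involves
    neither N nor the exponents of the denominators, as the majorant in [Li_expansion] requires. *)
Lemma strict_sum_le F z N : (forall i, 0 <= z i < 1) ->
  (forall n, strict_fun n -> 0 <= F n <= \prod_(i < s) z i ^+ n i) ->
  strict_sum F N <= \prod_(i < s) (1 - z i)^-1.
Proof.
move=> z01 FF; rewrite /strict_sum.
have z0 i : 0 <= z i by have /andP[] := z01 i.
apply: (@le_trans _ _ (\prod_(i < s) series (geometric 1 (z i)) N.+1)).
  rewrite box_series [leLHS]big_mkcond; apply: ler_sum => n _.
  case: ifPn => [sn|_]; last first.
    by apply: prodr_ge0 => i _; rewrite /= mul1r exprn_ge0.
  have /andP[_ /le_trans] := FF (ord_fun n) sn; apply.
  by under [leRHS]eq_bigr do rewrite /= mul1r.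
apply: ler_prod => i _; have /andP[_ z1] := z01 i.
rewrite sumr_ge0/=; last by move=> j _; rewrite mul1r exprn_ge0.
rewrite geometric_seriesE ?lt_eqF//= mul1r ler_piMl ?invr_ge0 ?subr_ge0 ?(ltW z1)//.
by rewrite gerBl exprn_ge0.
Qed.

Lemma polylog_term_bounds k z n : (forall i, 0 <= z i < 1) -> strict_fun n ->
  0 <= polylog_term k z n <= \prod_(i < s) z i ^+ n i.
Proof.
move=> z01 /andP[/forallP n0 _].
have z0 i : 0 <= z i by have /andP[] := z01 i.
apply/andP; split.
  by apply: prodr_ge0 => i _; rewrite divr_ge0 ?exprn_ge0 ?ler0n.
apply: ler_prod => i _; rewrite divr_ge0 ?exprn_ge0 ?ler0n//=.
rewrite ler_pdivrMr ?exprn_gt0 ?ltr0n// ler_peMr ?exprn_ge0//.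
by rewrite exprn_ege1// ler1n.
Qed.

Lemma Li_cvg k z : (forall i, 0 <= z i < 1) ->
  strict_sum (polylog_term k z) N @[N --> \oo] --> Li k z.
Proof.
move=> z01; have z0 i : 0 <= z i by have /andP[] := z01 i.
apply: (@nondecreasing_is_cvgn _ (strict_sum (polylog_term k z))).
  apply: strict_sum_nondecreasing => n; apply: prodr_ge0 => i _.
  by rewrite divr_ge0 ?exprn_ge0 ?ler0n.
exists (\prod_(i < s) (1 - z i)^-1) => _ [N _ <-].
by apply: strict_sum_le => // n; exact: polylog_term_bounds.
Qed.

(** For fixed N the shifted sum is a finite sum of Cauchy products, whose L-th term is that of the
    claim with each polylogarithm truncated at N; [tannery] then lets N grow. *)
Lemma Li_expansion k z (x : R) : 0 < x -> x < 1 -> (forall i, (0 < k i)%N) ->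
  (forall i, 0 <= z i < 1) ->
  exists2 E : R,
    series (fun L => (- x) ^+ L *
      \sum_(l : {ffun 'I_s -> 'I_L.+1} | (\sum_(i < s) l i == L)%N)
        (\prod_(i < s) 'C(k i + l i - 1, l i))%N%:R *
        Li (fun i => (k i + l i)%N) z) @ \oo --> E &
    strict_sum (fun n => \prod_(i < s) (z i ^+ n i / ((n i)%:R + x) ^+ k i)) N
      @[N --> \oo] --> E.
Proof.
move=> x0 x1 k0 z01.
have z0 i : 0 <= z i by have /andP[] := z01 i.
pose B := \prod_(i < s) (1 - z i)^-1.
pose bin L (l : {ffun 'I_s -> 'I_L.+1}) : R := (\prod_(i < s) 'C(k i + l i - 1, l i))%N%:R.
pose u L N := (- x) ^+ L * \sum_(l : {ffun 'I_s -> 'I_L.+1} | (\sum_(i < s) l i == L)%N)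
   bin L l * strict_sum (polylog_term (fun i => (k i + l i)%N) z) N.
(* The L-th term of prod_i (1 - x)^-(k_i), where the signs of -x are gone, times the bound [B] valid
   for every truncated polylogarithm. *)
pose b L := antidiag (fun i l => negbin_coef (k i).-1 x l) L * B.
have binE i (l : nat) : 'C(k i + l - 1, l) = 'C((k i).-1 + l, (k i).-1).
  by rewrite -{1}(prednK (k0 i)) addSn subn1/= -bin_sub ?leq_addl// addnK.
have strict_ge0 k' N : 0 <= strict_sum (polylog_term k' z) N.
  by apply: sumr_ge0 => n sn; have /andP[] := polylog_term_bounds k' z01 sn.
apply: (@tannery _ u _ b).
- move=> L N; rewrite /u /b normrM normrX normrN (gtr0_norm x0) /antidiag.
  rewrite mulr_suml; apply: le_trans (ler_wpM2l (exprn_ge0 _ (ltW x0)) (ler_norm_sum _ _ _)) _.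
  rewrite mulr_sumr; apply: ler_sum => l /eqP lL.
  rewrite normrM (ger0_norm (strict_ge0 _ _)) /bin normr_nat mulrA.
  have -> : \prod_(i < s) negbin_coef (k i).-1 x (l i) =
      x ^+ L * (\prod_(i < s) 'C(k i + l i - 1, l i))%N%:R.
    rewrite (_ : x ^+ L = \prod_(i < s) x ^+ l i); last by rewrite -expr_sum lL.
    rewrite natr_prod -big_split/=; apply: eq_bigr => i _.
    by rewrite /negbin_coef binE mulrC.
  rewrite ler_wpM2l ?mulr_ge0 ?exprn_ge0 ?ler0n ?(ltW x0)//.
  by apply: strict_sum_le => // n; exact: polylog_term_bounds.
- have -> : series b = (fun M => series (antidiag (fun i l => negbin_coef (k i).-1 x l)) M * B).
    by apply: funext => M; rewrite /series/= mulr_suml.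
  apply: is_cvgM; last exact: is_cvg_cst.
  apply/cvg_ex; eexists; apply: multi_cauchy_product => // i.
    have := @negbin_cvg_nonneg _ (k i).-1 x (ltW x0) x1.
    by rewrite (negbin_norm (k i).-1 x) gtr0_norm.
  by apply: negbin_series; rewrite gtr0_norm.
- move=> L; apply: cvgM; first exact: cvg_cst.
  apply: cvg_big; first exact: add_continuous.
  by move=> l _; apply: cvgM; [exact: cvg_cst|exact: Li_cvg].
- move=> N.
  pose t (n : 'I_s -> nat) i (l : nat) : R :=
    z i ^+ n i * ('C(k i + l - 1, l)%:R * (- x) ^+ l / (n i)%:R ^+ (k i + l)).
  have -> : series (u^~ N) = fun M => \sum_(n : {ffun 'I_s -> 'I_N.+1} | strict_indices n)
      series (antidiag (t (ord_fun n))) M.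
    apply: funext => M; rewrite /series/= exchange_big/=; apply: eq_bigr => L _.
    rewrite /u /antidiag exchange_big/= mulr_sumr; apply: eq_bigr => l /eqP lL.
    rewrite /strict_sum !mulr_sumr; apply: eq_bigr => n _.
    rewrite (_ : (- x) ^+ L = \prod_(i < s) (- x) ^+ l i); last by rewrite -expr_sum lL.
    rewrite /bin /polylog_term natr_prod -!big_split/=; apply: eq_bigr => i _.
    by rewrite /t /ord_fun; ring.
  apply: cvg_big; first exact: add_continuous.
  move=> n /andP[/forallP n0 _]; apply: multi_cauchy_product => // i.
    have [c _] := inv_pow_series x0 x1 (k0 i) (n0 i).
    have -> : (fun l => `|t (ord_fun n) i l|) = (fun l => `|z i ^+ n i| *
       `|'C(k i + l - 1, l)%:R * (- x) ^+ l / (n i)%:R ^+ (k i + l)|).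
      by apply: funext => l; rewrite /t normrM.
    have -> : forall c (f : nat -> R), series (fun l => c * f l) = (fun M => c * series f M).
      by move=> c' f; apply: funext => M; rewrite /series/= mulr_sumr.
    by apply: is_cvgM => //; exact: is_cvg_cst.
  have [_ c] := inv_pow_series x0 x1 (k0 i) (n0 i).
  have -> : series (t (ord_fun n) i) = (fun M => z i ^+ n i *
      series (fun l => 'C(k i + l - 1, l)%:R * (- x) ^+ l / (n i)%:R ^+ (k i + l)) M).
    by apply: funext => M; rewrite /series/= mulr_sumr.
  by apply: cvgM => //; exact: cvg_cst.
Qed.

End multi_polylog.

(** * Level sets and the arguments of the polylogarithms *)

Section block_weights.
Variables (R : realType) (r : nat) (omega : 'I_r -> R) (a x : R) (N : nat).
Hypotheses (omega_gt0 : forall i, 0 < omega i) (a_ge0 : 0 <= a).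
Hypothesis tot_gt0 : 0 < a + sum_on omega [set: 'I_r]%SET.
Local Notation M := N.+1.
Local Notation Wt := (fun_weight omega a x).

Section one_family.
Variables (s : nat) (K : {ffun 'I_s -> {set 'I_r}}) (n : {ffun 'I_s -> 'I_M}).
Hypotheses (Kd : nonempty_disjoint K) (nd : strict_indices n).
Let f := blocks_to_fun (K, n).

Lemma K_upto_s : K_upto K s = [set: 'I_r]%SET.
Proof.
rewrite /K_upto [X in (_ :|: X)%SET](eq_bigl predT); last by move=> i; apply: ltn_ord.
by rewrite finset.setUC finset.setUCr.
Qed.

(** At m = 0 the sum vanishes when a = 0 and K_0 is empty; from m = 1 on, the nonempty first block
    makes it positive. *)
Lemma K_upto_gt0 m : (0 < m)%N -> (m <= s)%N -> 0 < a + sum_on omega (K_upto K m).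
Proof.
move=> m0 ms; have s0 : (0 < s)%N by exact: leq_trans ms.
rewrite ltr_wpDl//; pose j0 := Ordinal s0.
have /andP[/forallP/(_ j0)/set0Pn[i ij] _] := Kd.
rewrite /sum_on (bigD1 i)/=; last first.
  by rewrite !inE; apply/orP; right; apply/bigcupP; exists j0.
by rewrite ltr_pwDl// sumr_ge0// => j _; exact: ltW.
Qed.

(** The nonempty block K_j adds positive weight to the denominator. The value 0 does occur, at the
    first index, when a = 0 and K_0 is empty. *)
Lemma z_arg_bounds j : 0 <= z_arg omega a K j < 1.
Proof.
have p : 0 < a + sum_on omega (K_upto K j.+1) by exact: K_upto_gt0.
rewrite /z_arg; apply/andP; split.
  by apply: divr_ge0; [rewrite addr_ge0 ?sum_on_ge0|exact: ltW].
rewrite ltr_pdivrMr// mul1r ltrD2l.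
have sub : K_upto K j \subset K_upto K j.+1.
  apply: finset.setUS; apply/bigcupsP => i ij; apply: (bigcup_max i) => //.
  by rewrite ltnS ltnW.
have /andP[/forallP/(_ j)/set0Pn[i ij] _] := Kd.
have iN : i \notin K_upto K j.
  rewrite !inE negb_or negbK; apply/andP; split.
    by apply/bigcupP; exists j.
  apply/negP => /bigcupP[j' j'j ij'].
  by move: j'j; rewrite (disjoint_mem_eq Kd ij' ij) ltnn.
have iY : i \in K_upto K j.+1.
  by rewrite !inE; apply/orP; right; apply/bigcupP; exists j => //=.
rewrite /sum_on (bigID (mem (K_upto K j)))/= [ltRHS](bigID (mem (K_upto K j)))/=.
rewrite [X in X + _ < _](eq_bigl (mem (K_upto K j))); last first.
  by move=> k; rewrite andbb.
rewrite [X in _ + X < _]big_pred0 ?addr0; last by move=> k; rewrite andbN.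
rewrite (eq_bigl (mem (K_upto K j))); last first.
  by move=> k /=; case kK : (k \in K_upto K j); rewrite ?andbF// (fintype.subsetP sub).
rewrite ltrDl (bigD1 i)/= ?iY ?iN// ltr_pwDl// sumr_ge0// => k _; exact: ltW.
Qed.

(** If m blocks have n_j <= w, the indices with f <= w form [K_upto K m], and its weight over the
    total telescopes into the z_j with j >= m. *)
Lemma ratio_levels (w : nat) : ratio omega a [set i | (w < f i)%N]%SET =
  \prod_(j < s | (w < n j)%N) z_arg omega a K j.
Proof.
(* The least such m is the first j with n_j > w, or s if there is none; as n increases, it counts
   the blocks with n_j <= w. *)
pose P m := (m == s) || [exists j : 'I_s, (j == m :> nat) && (w < n j)%N].
have exP : exists m, P m by exists s; rewrite /P eqxx.
case: (ex_minnP exP) => m Pm mmin.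
have ms : (m <= s)%N by apply: mmin; rewrite /P eqxx.
have wE (j : 'I_s) : (w < n j)%N = (m <= j)%N.
  apply/idP/idP => [wj|mj].
    by apply: mmin; apply/orP; right; apply/existsP; exists j; rewrite eqxx.
  move: Pm; rewrite /P => /orP[/eqP E|/existsP[j0 /andP[/eqP j0m wj0]]].
    by move: mj; rewrite E leqNgt ltn_ord.
  move: mj; rewrite -j0m leq_eqVlt => /orP[/eqP/val_inj <-//|/(strict_lt nd)].
  exact: ltn_trans.
have -> : ratio omega a [set i | (w < f i)%N]%SET =
    (a + sum_on omega (K_upto K m)) / (a + sum_on omega (K_upto K s)).
  rewrite /ratio K_upto_s; congr ((_ + sum_on _ _) / _); apply/finset.setP => i.
  rewrite !inE -leqNgt.
  have [/bigcupP[j _ ij]|iK] /= := boolP (i \in (\bigcup_j K j)%SET); last first.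
    by rewrite /f (blocks_to_fun_notin n iK).
  rewrite /f (blocks_to_fun_in n Kd ij) leqNgt wE -ltnNge.
  apply/idP/bigcupP => [jm|[j' j'm ij']]; first by exists j.
  by rewrite (disjoint_mem_eq Kd ij ij').
rewrite (eq_bigl (fun j : 'I_s => (m <= j)%N)); last by move=> j; exact: wE.
pose A m := a + sum_on omega (K_upto K m).
have -> : \prod_(j < s | (m <= j)%N) z_arg omega a K j = \prod_(m <= j < s) (A j / A j.+1).
  by rewrite [RHS](big_nat_widenl m 0%N)// big_mkord.
move: ms; rewrite leq_eqVlt => /orP[/eqP ->|ms].
  by rewrite big_geq// divff// K_upto_s gt_eqF.
(* Only the intermediate values strictly between m and s have to be nonzero; their indices are
   positive, so [K_upto_gt0] applies. *)
rewrite telescope_prodr// => k /andP[mk ks]; rewrite unitfE gt_eqF// K_upto_gt0 ?(ltnW ks)//.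
by case: k mk {ks}.
Qed.

(** The factor z_j enters at the levels 0, ..., n_j - 1, all of which are below M. *)
Lemma prod_ratio_levels : \prod_(w < M) ratio omega a [set i | (w < f i)%N]%SET =
  \prod_(j < s) z_arg omega a K j ^+ n j.
Proof.
under eq_bigr do rewrite ratio_levels.
rewrite (exchange_big_dep predT)//=; apply: eq_bigr => j _.
rewrite prodr_const; congr (_ ^+ _).
have nM : (n j <= M)%N by exact: ltnW.
rewrite -[RHS](card_ord (n j)) -!sum1_card (big_ord_widen _ (fun=> 1%N) nM).
by apply: eq_bigl.
Qed.

Lemma prod_block_weight : (forall w : nat, x + w%:R != 0) ->
  \prod_(w < M) Wt f w =
  (r - \sum_(j < s) #|K j|)`!%:R / x ^+ (r - \sum_(j < s) #|K j|) *
  (\prod_(j < s) (#|K j|)`!)%N%:R *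
  \prod_(j < s) (z_arg omega a K j ^+ n j / ((n j)%:R + x) ^+ #|K j|).
Proof.
move=> xw; rewrite /fun_weight big_split/= prod_ratio_levels.
pose G (w : nat) : R := (#|[set i | f i == w :> nat]%SET|)`!%:R /
  (x + w%:R) ^+ #|[set i | f i == w :> nat]%SET|.
(* Levels other than 0 and the n_j have empty level sets and contribute 0! = 1. *)
have -> : \prod_(w < M) G w = G 0%N * \prod_(j < s) G (n j).
  rewrite (bigD1 ord0)//=; congr (_ * _).
  rewrite (bigID (mem [set n j | j in 'I_s]%SET))/= [X in _ * X]big1 ?mulr1; last first.
    move=> w /andP[w0 wn]; rewrite /G (_ : [set i | _]%SET = set0) ?cards0 ?fact0 ?expr0 ?divr1//.
    apply/finset.setP => i; rewrite !inE; apply/negP => /eqP fiw.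
    have iK : i \in (\bigcup_j K j)%SET.
      rewrite -[_ \in _]negbK -(blocks_to_fun_eq0 Kd nd) -/f fiw.
      by apply: contra w0 => /eqP E; apply/eqP/val_inj.
    move/bigcupP : iK => [j _ ij]; case/negP: wn; apply/imsetP; exists j => //.
    by apply/val_inj; rewrite /= -fiw /f (blocks_to_fun_in n Kd ij).
  rewrite (eq_bigl (mem [set n j | j in 'I_s]%SET)); last first.
    move=> w /=; rewrite andb_idl// => /imsetP[j _ ->].
    by rewrite -val_eqE/= -lt0n (strict_gt0 nd).
  by rewrite big_imset//= => i j _ _; exact: (strict_inj nd).
have -> : G 0%N = (r - \sum_(j < s) #|K j|)`!%:R / x ^+ (r - \sum_(j < s) #|K j|).
  rewrite /G addr0 (_ : [set i | _]%SET = (~: (\bigcup_j K j))%SET); last first.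
    by apply/finset.setP => i; rewrite !inE (blocks_to_fun_eq0 Kd nd).
  by rewrite cardsCs finset.setCK card_ord (card_bigcup Kd).
have GE j : G (n j) = (#|K j|)`!%:R / ((n j)%:R + x) ^+ #|K j|.
  rewrite /G (_ : [set i | _]%SET = K j) 1?[x + _]addrC//.
  by apply/finset.setP => i; rewrite inE -(blocks_to_fun_eq Kd nd).
rewrite -!mulrA; congr (_ * (_ * _)).
rewrite natr_prod -!big_split/=; apply: eq_bigr => j _; rewrite GE; ring.
Qed.

End one_family.

Lemma sum_disjoint_family s t (F : {ffun 'I_s -> {set 'I_r}} -> R) :
  \sum_(K | nonempty_disjoint K && (\sum_j #|K j| == t)%N) F K =
  \sum_(k : {ffun 'I_s -> 'I_t.+1} |
      [forall i : 'I_s, (1 <= k i)%N] && (\sum_(i < s) k i == t)%N)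
    \sum_(K : {ffun 'I_s -> {set 'I_r}} | disjoint_family (fun i => k i : nat) K) F K.
Proof.
pose kof (K : {ffun 'I_s -> {set 'I_r}}) : {ffun 'I_s -> 'I_t.+1} := [ffun i => inord #|K i|].
have kofE (K : {ffun 'I_s -> {set 'I_r}}) (i : 'I_s) : (\sum_j #|K j| == t)%N -> kof K i = #|K i| :> nat.
  by move=> /eqP st; rewrite ffunE inordK// ltnS -st (bigD1 i)//= leq_addr.
rewrite (partition_big kof (fun k : {ffun 'I_s -> 'I_t.+1} =>
   [forall i : 'I_s, (1 <= k i)%N] && (\sum_(i < s) k i == t)%N)); last first.
  move=> K /andP[/andP[/forallP K0 _] st]; apply/andP; split.
    by apply/forallP => i; rewrite kofE// card_gt0.
  by under eq_bigr do rewrite kofE//.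
apply: eq_bigr => k /andP[/forallP k1 /eqP kt]; apply: eq_bigl => K.
apply/andP/andP => [[/andP[/andP[_ Kd] st] /eqP <-]|[/forallP Kk Kd]].
  by split=> //; apply/forallP => i; rewrite kofE.
have st : (\sum_j #|K j| == t)%N.
  by rewrite -kt; apply/eqP; apply: eq_bigr => j _; apply/eqP/Kk.
split; last by apply/eqP/ffunP => i; apply/val_inj; rewrite /= kofE//; apply/eqP/Kk.
rewrite st andbT; apply/andP; split=> //; apply/forallP => i.
by rewrite -card_gt0 (eqP (Kk i)).
Qed.

Lemma sum_prod_fun_weight : (forall w : nat, x + w%:R != 0) ->
  \sum_(f : {ffun 'I_r -> 'I_M}) \prod_(w < M) Wt f w =
  r`!%:R / x ^+ r +
  \sum_(1 <= t < r.+1) \sum_(1 <= s < t.+1)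
  \sum_(k : {ffun 'I_s -> 'I_t.+1} |
      [forall i : 'I_s, (1 <= k i)%N] && (\sum_(i < s) k i == t)%N)
  \sum_(K : {ffun 'I_s -> {set 'I_r}} | disjoint_family (fun i => k i : nat) K)
    (r - t)`!%:R / x ^+ (r - t) * (\prod_(i < s) (k i)`!)%N%:R *
    strict_sum (fun n => \prod_(i < s) (z_arg omega a K i ^+ n i /
      ((n i)%:R + x) ^+ k i)) N.
Proof.
move=> xw.
rewrite (@sum_partition_nat _ _ _ _ (@supp r N) 0 r.+1); last first.
  by move=> f _; rewrite /= ltnS; apply: leq_trans (max_card _) _; rewrite card_ord.
(* The part t = 0 consists of the zero function alone: all r indices sit at level 0, and every ratio
   is that of the empty set. *)
rewrite big_ltn//; congr (_ + _).
  rewrite (big_pred1 [ffun=> ord0]); last first.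
    move=> f /=; apply/eqP/eqP => [/eqP|->].
      rewrite cards_eq0 => /eqP f0; apply/ffunP => i; rewrite ffunE; apply/val_inj/eqP.
      by have := finset.in_set0 i; rewrite -f0 inE lt0n => /negbFE.
    by apply/eqP; rewrite cards_eq0; apply/eqP/finset.setP => i; rewrite !inE ffunE.
  rewrite (bigD1 ord0)//= big1 ?mulr1.
    rewrite /fun_weight (_ : [set i | (_ < _)%N]%SET = set0) ?ratio0//; last first.
      by apply/finset.setP => i; rewrite !inE ffunE.
    rewrite (_ : [set i | _]%SET = [set: 'I_r]%SET) ?cardsT ?card_ord ?addr0 ?mulr1//.
    by apply/finset.setP => i; rewrite !inE ffunE.
  move=> w w0; rewrite /fun_weight (_ : [set i | (_ < _)%N]%SET = set0) ?ratio0//; last first.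
    by apply/finset.setP => i; rewrite !inE ffunE.
  rewrite (_ : [set i | _]%SET = set0) ?cards0 ?fact0 ?expr0 ?divr1 ?mulr1//.
  apply/finset.setP => i; rewrite !inE ffunE; apply/negbTE.
  by apply: contra w0 => /eqP E; apply/eqP/val_inj.
rewrite [LHS]big_nat [RHS]big_nat; apply: eq_bigr => t /andP[t1 tr].
rewrite (@sum_partition_nat _ _ _ _ (fun f : {ffun 'I_r -> 'I_M} => size (vals f)) 1 t.+1); last first.
  move=> f /= /eqP ft; apply/andP; split; first by apply: size_vals_gt0; rewrite ft.
  by rewrite ltnS -ft size_vals_le.
apply: eq_bigr => s _.
rewrite [LHS]sum_blocks sum_disjoint_family; apply: eq_bigr => k /andP[/forallP k1 /eqP kt].
apply: eq_bigr => K /andP[/forallP Kk Kd'].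
rewrite /strict_sum mulr_sumr; apply: eq_bigr => n nd.
have kE i : #|K i| = k i by apply/eqP/Kk.
have Kd : nonempty_disjoint K.
  by apply/andP; split=> //; apply/forallP => i; rewrite -card_gt0 kE.
rewrite (prod_block_weight Kd nd xw); under eq_bigr do rewrite kE.
rewrite kt; congr (_ * _%:R * _); apply: eq_bigr => i _; by rewrite kE.
Qed.

End block_weights.

(** * The expansion in powers of x *)

Lemma cvg_sum_nat (R : realType) (a b : nat) (f : nat -> nat -> R) (l : nat -> R) :
  (forall i, (a <= i < b)%N -> f i n @[n --> \oo] --> l i) ->
  \sum_(a <= i < b) f i n @[n --> \oo] --> \sum_(a <= i < b) l i.
Proof.
move=> fl; rewrite big_nat.
have -> : (fun n => \sum_(a <= i < b) f i n) =
    (fun n => \sum_(a <= i < b | (a <= i < b)%N) f i n).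
  by apply: funext => n; rewrite big_nat.
by apply: cvg_big; [exact: add_continuous|].
Qed.

Section assembly.
Variables (R : realType) (r : nat) (omega : 'I_r -> R) (a x : R).
Hypotheses (omega_gt0 : forall i, 0 < omega i) (a_ge0 : 0 <= a).
Hypotheses (x_gt0 : 0 < x) (x_lt1 : x < 1).

Definition Li_term (s : nat) (k : 'I_s -> nat) (z : 'I_s -> R) (L : nat) : R :=
  (- x) ^+ L * \sum_(l : {ffun 'I_s -> 'I_L.+1} | (\sum_(i < s) l i == L)%N)
    (\prod_(i < s) 'C(k i + l i - 1, l i))%N%:R * Li (fun i => (k i + l i)%N) z.

Definition shifted_sum (s : nat) (k : 'I_s -> nat) (z : 'I_s -> R) (N : nat) : R :=
  strict_sum (fun n => \prod_(i < s) (z i ^+ n i / ((n i)%:R + x) ^+ k i)) N.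

(** The slot [F] takes in turn a term of the power series in x, a partial sum of it, the shifted sum
    up to N, and their common limit, so that [block_sum_cvg] serves both limits. *)
Definition block_sum (F : forall s : nat, ('I_s -> nat) -> ('I_s -> R) -> R) (t : nat) : R :=
  \sum_(1 <= s < t.+1)
  \sum_(k : {ffun 'I_s -> 'I_t.+1} |
      [forall i : 'I_s, (1 <= k i)%N] && (\sum_(i < s) k i == t)%N)
  \sum_(K : {ffun 'I_s -> {set 'I_r}} | disjoint_family (fun i => k i : nat) K)
    (r - t)`!%:R / x ^+ (r - t) * (\prod_(i < s) (k i)`!)%N%:R *
    F s (fun i => k i : nat) (z_arg omega a K).

Lemma block_sum_cvg (F : nat -> forall s : nat, ('I_s -> nat) -> ('I_s -> R) -> R)
    (G : forall s : nat, ('I_s -> nat) -> ('I_s -> R) -> R) (t : nat) :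
  (forall (s : nat) (k : 'I_s -> nat) (z : 'I_s -> R), (0 < s)%N ->
     (forall i, (0 < k i)%N) -> (forall i, 0 <= z i < 1) ->
     F N s k z @[N --> \oo] --> G s k z) ->
  block_sum (F N) t @[N --> \oo] --> block_sum G t.
Proof.
move=> FG; apply: cvg_sum_nat => s /andP[s0 _].
apply: cvg_big => [|k /andP[/forallP k1 _]]; first exact: add_continuous.
apply: cvg_big => [|K /andP[/forallP Kk Kd]]; first exact: add_continuous.
apply: cvgM; first exact: cvg_cst.
apply: FG => // j; apply: z_arg_bounds => //.
apply/andP; split=> //; apply/forallP => i.
by rewrite -card_gt0 (eqP (Kk i)).
Qed.

(** Since x^(m-r) = x^(m-t) / x^(r-t), the sign (-1)^(m-t) joins the numerator to give
    (-x)^(m-t). *)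
Lemma c_coef_term (m t : nat) : (1 <= t)%N -> (t <= m)%N -> (t <= r)%N ->
  (-1) ^+ (m - t) *
  (\sum_(1 <= s < t.+1)
  \sum_(k : {ffun 'I_s -> 'I_t.+1} |
      [forall i : 'I_s, (1 <= k i)%N] && (\sum_(i < s) k i == t)%N)
  \sum_(l : {ffun 'I_s -> 'I_(m - t).+1} | (\sum_(i < s) l i == m - t)%N)
    ((r - t)`! * \prod_(i < s) (k i)`!
      * \prod_(i < s) 'C(k i + l i - 1, l i))%N%:R *
    \sum_(K : {ffun 'I_s -> {set 'I_r}} |
        disjoint_family (fun i => k i : nat) K)
      Li (fun i => (k i + l i)%N) (z_arg omega a K)) * x ^ (m%:Z - r%:Z) =
  block_sum (fun s k z => Li_term k z (m - t)) t.
Proof.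
move=> t1 tm tr; rewrite /block_sum mulrAC.
have -> : (-1) ^+ (m - t) * x ^ (m%:Z - r%:Z) = (- x) ^+ (m - t) / x ^+ (r - t).
  have -> : m%:Z - r%:Z = (m - t)%N%:Z - (r - t)%N%:Z by lia.
  by rewrite expfzDr ?gt_eqF// -exprnN [in RHS]exprNn -!mulrA.
rewrite mulr_sumr; apply: eq_bigr => s _.
rewrite mulr_sumr; apply: eq_bigr => k _.
rewrite /Li_term mulr_sumr.
under [RHS]eq_bigr do rewrite !mulr_sumr.
rewrite [RHS]exchange_big/=; apply: eq_bigr => l _.
rewrite !mulr_sumr; apply: eq_bigr => K _.
by rewrite !natrM; ring.
Qed.

(** With L = m - t, the range t <= m <= N becomes N + 1 - t terms from L = 0 on; truncated
    subtraction gives the empty sum when t > N. *)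
Lemma c_coef_partial_sum (N : nat) :
  \sum_(1 <= m < N.+1) c_coef omega a m * x ^ (m%:Z - r%:Z) =
  \sum_(1 <= t < r.+1)
    block_sum (fun s k z => series (Li_term k z) (N.+1 - t)%N) t.
Proof.
transitivity (\sum_(1 <= m < N.+1) \sum_(1 <= t < r.+1 | (t <= m)%N)
    block_sum (fun s k z => Li_term k z (m - t)) t).
  apply: eq_bigr => m _; rewrite /c_coef mulr_suml.
  have mr : ((minn m r).+1 <= r.+1)%N by rewrite ltnS geq_minr.
  rewrite (big_nat_widen _ _ _ _ _ mr) /= big_nat_cond [RHS]big_nat_cond.
  apply: eq_big => [t|t /andP[/andP[t1 tr] tm]]; first by lia.
  by apply: c_coef_term => //; lia.
rewrite (exchange_big_dep_nat xpredT)//=; rewrite big_nat [RHS]big_nat.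
apply: eq_bigr => t /andP[t1 tr].
rewrite -(big_nat_widenl t 1 N.+1 xpredT)// -{1}[t]add0n big_addn.
rewrite /block_sum exchange_big/=; apply: eq_bigr => s _.
rewrite exchange_big/=; apply: eq_bigr => k _.
rewrite exchange_big/=; apply: eq_bigr => K _.
rewrite /series/= mulr_sumr; apply: eq_bigr => j _.
by rewrite addnK.
Qed.

End assembly.

Theorem theorem1p3 (R : realType) (r : nat) (omega : 'I_r -> R) (a x : R)
    (r_gt0 : (0 < r)%N) (omega_gt0 : forall i, 0 < omega i) (a_ge0 : 0 <= a)
    (x_gt0 : 0 < x) (x_lt1 : x < 1) :
  I_integral x omega a \is a fin_num /\
  (fun N : nat => (r`!)%:R * x ^- r
     + \sum_(1 <= m < N.+1) c_coef omega a m * x ^ (m%:Z - r%:Z)) @ \oo -->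
  (a + sum_on omega [set: 'I_r]%SET) `^ x * fine (I_integral x omega a).
Proof.
have tot_gt0 : 0 < a + sum_on omega [set: 'I_r]%SET.
  apply: ltr_wpDl => //; rewrite /sum_on (bigD1 (Ordinal r_gt0)) ?finset.in_setT//=.
  by apply: ltr_pwDl => //; apply: sumr_ge0 => i _; exact: ltW.
have nIE : nI omega a x [set: 'I_r]%SET =
    (a + sum_on omega [set: 'I_r]%SET) `^ x * fine (I_integral x omega a).
  rewrite /nI I_integralE// finset.setCT {2}/sum_on big_set0 addr0.
  by congr (_ * fine (Iw (map _ _) _ _)); rewrite enum_setT -enumT.
split.
  rewrite I_integralE//; apply: Iw_fin_num => //; first exact: enum_uniq.
  by apply/orP; right; rewrite -size_eq0 size_enum_ord -lt0n.
have xw (w : nat) : x + w%:R != 0 by rewrite gt_eqF// ltr_pwDl.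
pose G (s : nat) (k : 'I_s -> nat) (z : 'I_s -> R) : R := limn (shifted_sum x k z).
have lims s (k : 'I_s -> nat) (z : 'I_s -> R) : (0 < s)%N ->
    (forall i, (0 < k i)%N) -> (forall i, 0 <= z i < 1) ->
    series (Li_term x k z) @ \oo --> G s k z /\
    shifted_sum x k z @ \oo --> G s k z.
  move=> s0 k0 z01; have [E E1 E2] := Li_expansion s0 x_gt0 x_lt1 k0 z01.
  have -> : G s k z = E by apply/cvg_lim.
  by [].
(* Both sides are limits of the truncation after N + 1 unrollings, one by [trunc_cvg], the other
   after rewriting it as a sum over blocks; uniqueness of limits identifies them. *)
have -> : (a + sum_on omega [set: 'I_r]%SET) `^ x * fine (I_integral x omega a) =
    r`!%:R * x ^- r + \sum_(1 <= t < r.+1) block_sum omega a x G t.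
  rewrite -nIE.
  have c1 : trunc omega a N.+1 x [set: 'I_r]%SET @[N --> \oo] -->
      nI omega a x [set: 'I_r]%SET.
    rewrite (cvg_shiftS (fun N => trunc omega a N x [set: 'I_r]%SET)).
    exact: trunc_cvg.
  have E N : trunc omega a N.+1 x [set: 'I_r]%SET = r`!%:R * x ^- r +
      \sum_(1 <= t < r.+1) block_sum omega a x (fun s k z => shifted_sum x k z N) t.
    by rewrite trunc_funE// sum_prod_fun_weight.
  apply: (cvg_unique (@norm_hausdorff _ R) c1); rewrite /=.
  rewrite (funext E); apply: cvgD; first exact: cvg_cst.
  apply: cvg_sum_nat => t _.
  apply: (@block_sum_cvg _ _ omega a x omega_gt0 a_ge0
    (fun N s k z => shifted_sum x k z N) G) => s k z s0 k0 z01.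
  by have [] := lims s k z s0 k0 z01.
apply: cvgD; first exact: cvg_cst.
under eq_fun do rewrite c_coef_partial_sum//.
apply: cvg_sum_nat => t _.
apply: (@block_sum_cvg _ _ omega a x omega_gt0 a_ge0
  (fun N s k z => series (Li_term x k z) (N.+1 - t)%N) G) => s k z s0 k0 z01.
have [+ _] := lims s k z s0 k0 z01.
(* The cut N + 1 - t depends on t but tends to infinity for each of the finitely many t. *)
apply: cvg_comp => A [M _ MA]; exists (M + t)%N => // n /= Mn; apply: MA => /=; lia.
Qed.
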